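(* Let $\psi:\mathbb{N}\to\mathbb{R}$ be any nonnegative function. If \[ \sum_{n\in\mathbb{N}}\left(\frac{\psi(n)}{n}\right)^{1-\epsilon}\varphi(n)=\infty\qquad\text{for every }\epsilon>0, \] then $\dim W(\psi)=1$.
   Context: $\varphi$ denotes Euler's totient function and $\dim$ denotes Hausdorff dimension (with $\mathbb{R}/\mathbb{Z}$ identified with $[0,1)\subset\mathbb{R}$). For each positive integer $n$, let \[ \mathcal{E}_n=\bigcup_{\substack{1\le a\le n\\ \gcd(a,n)=1}}\left(\frac{a-\psi(n)}{n},\frac{a+\psi(n)}{n}\right)\subseteq \mathbb{R}/\mathbb{Z}, \] and let $W(\psi)=\bigcap_{m=1}^\infty\bigcup_{n\ge m}\mathcal{E}_n$, the set of points lying in infinitely many of the sets $\mathcal{E}_n$. *)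

(* Defs.v *)
(* MathComp-Analysis; the reals are an arbitrary R : realType. *)
From HB Require Import structures.
From mathcomp Require Import all_boot all_order all_algebra.
From mathcomp Require Import all_classical all_reals all_analysis.

Set Implicit Arguments.
Unset Strict Implicit.
Unset Printing Implicit Defensive.

Import Order.TTheory GRing.Theory Num.Theory.
Import numFieldNormedType.Exports.

Local Open Scope classical_set_scope.
Local Open Scope ring_scope.

(* For U = set0 this is -oo, the supremum of the empty set in \bar R. *)
Definition diameter (R : realType) (U : set R) : \bar R :=
  ereal_sup [set d | exists x y : R, [/\ U x, U y & d = `|x - y|%:E]].

(* The s-th power of the diameter, with the usual conventions: the empty set
   counts for 0, and 0 `^ 0 = 1, so that nonempty sets count for 1 at s = 0. *)
Definition diameter_pow (R : realType) (s : R) (U : set R) : \bar R :=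
  if U == set0 then 0%E else poweR (diameter U) s.

(* Finite covers are included, by padding with set0. *)
Definition hausdorff_premeasure (R : realType) (s delta : R) (A : set R) :
    \bar R :=
  ereal_inf [set (\sum_(0 <= i <oo) diameter_pow s (U i))%E | U in
    [set U : nat -> set R | A `<=` \bigcup_i U i /\
                            forall i, (diameter (U i) <= delta%:E)%E]].

Definition hausdorff_measure (R : realType) (s : R) (A : set R) : \bar R :=
  ereal_sup [set hausdorff_premeasure s delta A | delta in
    [set delta : R | 0 < delta]].

Definition hausdorff_dim (R : realType) (A : set R) : \bar R :=
  ereal_inf [set s%:E | s in
    [set s : R | 0 <= s /\ hausdorff_measure s A = 0%E]].

(* R/Z is represented by its fundamental domain [0, 1[: a point x lies in the
   image of an open interval of the real line when one of its integer
   translates x + k lies in this interval. *)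
Definition approx_set (R : realType) (psi : nat -> R) (n : nat) : set R :=
  [set x : R | 0 <= x < 1 /\
    exists (a : nat) (k : int), [/\ (1 <= a <= n)%N, coprime a n &
      (a%:R - psi n) / n%:R < x + k%:~R < (a%:R + psi n) / n%:R]].

Definition W (R : realType) (psi : nat -> R) : set R :=
  \bigcap_(m in [set m : nat | (1 <= m)%N])
    \bigcup_(n in [set n : nat | (m <= n)%N]) approx_set psi n.

(* Real powers of x >= 0 with 0 to a negative power equal to +oo, whereas
   powR returns 0 there. *)
Definition epowR (R : realType) (x s : R) : \bar R :=
  if (x == 0) && (s < 0) then +oo%E else (powR x s)%:E.

(* Main.v *)
(* A divergent series at every exponent below 1 yields, for infinitely many k, a
   set A of n in [2^k, 2^(k+1)) and a radius r <= 2^-k with psi n / n > r on A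
   and |A| 2^k >= r^-s0, where s0 < 1 is arbitrary. In a given interval the
   reduced fractions with denominator in A are well distributed at large scales
   by an elementary sieve, and at small scales, after discarding at most half of
   them, because the sum of 1 / |p - q| over pairs is nearly as small as for
   independent points. Given a cover of small s-dimensional cost, averaging over
   these fractions finds one whose interval of radius r meets sets of
   proportionally small cost; iterating gives nested intervals shrinking to a
   point of W psi that the cover misses. *)
Require Import Defs.
From HB Require Import structures.
From mathcomp Require Import all_boot all_order all_algebra.
From mathcomp Require Import all_classical all_reals all_analysis.
From mathcomp Require Import ring lra zify.

Set Implicit Arguments.
Unset Strict Implicit.
Unset Printing Implicit Defensive.

Import Order.TTheory GRing.Theory Num.Theory.
Import numFieldNormedType.Exports.

Local Open Scope classical_set_scope.
Local Open Scope ring_scope.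

(** The obstacle is that psi has no monotonicity: A may be a sparse subset of its dyadic block, and
    its fractions may cluster. What saves the argument is the gap between s and 1, which leaves a
    spare power of 2^k. Every loss (the factor 2^omega(n) of the sieve, omega(n) being the number of
    primes dividing n, the logarithm in the sum of 1 / |p - q|, all constants) is charged to a
    factor X, a tiny power of 2^k, so crude estimates are enough. The two regimes meet at the scale
    X^2 / 2^k: above it the main term of the sieve exceeds its error, below it the fractions are
    counted by Markov's inequality from the energy, the sum of 1 / |p - q|. No measure is built on
    the limsup set. The cover is fixed beforehand, and the invariant of the nested intervals is that
    the sets meeting an interval of radius l cost at most l^s / 56. Here 28 is the constant in the
    bound for the number of chosen fractions near a given one, and 56 = 2 * 28 makes the average
    truncated cost at most half the allowed one. *)

(** * Bounding 2^omega(n) by a small power of n *)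

(** Split the primes of n at D = 2^M. At most D of them are below D, which gives the constant D^D;
    each of the others is at least D, so their factors D are paid by the product of the primes of n,
    which is at most n. *)
Lemma expn_omega_le (M n : nat) : (0 < n)%N ->
  ((2 ^ M) ^ size (primes n) <= (2 ^ M) ^ (2 ^ M) * n)%N.
Proof.
move=> n0; set D := (2 ^ M)%N.
have D0 : (0 < D)%N by rewrite expn_gt0.
have rad_le : (\prod_(p <- primes n) p <= n)%N.
  rewrite [X in (_ <= X)%N](prod_prime_decomp n0) prime_decompE big_map /=.
  rewrite big_seq_cond [X in (_ <= X)%N]big_seq_cond.
  apply: leq_prod => p; rewrite andbT => pn.
  rewrite -{1}(expn1 p) leq_pexp2l ?logn_gt0 //.
  by move: pn; rewrite mem_primes => /and3P[/prime_gt0].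
have cnt_le : (count (fun p => p < D)%N (primes n) <= D)%N.
  rewrite -size_filter -[X in (_ <= X)%N](size_iota 0 D).
  apply: uniq_leq_size; first by rewrite filter_uniq ?primes_uniq.
  by move=> p; rewrite mem_filter mem_iota /= => /andP[].
apply: leq_trans (leq_mul (leq_pexp2l D0 cnt_le) rad_le).
have : all (fun p => 0 < p)%N (primes n).
  by apply/allP => p; rewrite mem_primes => /and3P[/prime_gt0].
elim: (primes n) => [|p ps IH] /=; first by rewrite big_nil.
move=> /andP[p0 /IH{}IH]; rewrite big_cons expnS.
case: ltnP => pD; rewrite ?add1n ?add0n ?expnS.
  rewrite -mulnA leq_mul2l (leq_trans IH) ?orbT // leq_mul2l.
  by rewrite leq_pmull ?orbT.
by rewrite mulnCA leq_mul.
Qed.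

Lemma omega_le_powR (R : realType) (M n : nat) : (0 < M)%N -> (0 < n)%N ->
  (2 ^ size (primes n))%:R <= 2 `^ ((2 ^ M)%:R) * n%:R `^ (M%:R^-1) :> R.
Proof.
move=> M0 n0.
have := expn_omega_le M n0; rewrite -(ler_nat R) natrM.
have M0' : (0 : R) <= M%:R^-1 by rewrite invr_ge0.
move=> /(ge0_ler_powR M0'); rewrite !nnegrE ler0n mulr_ge0 // => /(_ isT isT).
rewrite powRM //.
have MM : (M%:R : R) * M%:R^-1 = 1 by rewrite divff ?pnatr_eq0 -?lt0n.
have e (x : nat) : (((2 ^ M) ^ x)%:R : R) `^ (M%:R^-1) = 2 `^ x%:R.
  rewrite -expnM mulnC expnM !natrX -[_ ^+ M]powR_mulrn ?exprn_ge0 //.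
  by rewrite -powRrM MM powRr1 ?exprn_ge0 // powR_mulrn.
by rewrite !e [2 `^ (size _)%:R]powR_mulrn // -natrX.
Qed.

(** * Legendre's sieve in an interval *)

Definition sieve (ps : seq nat) (a : nat) := all (fun p => ~~ (p %| a))%N ps.

Lemma coprime_sieve (a n : nat) : (0 < n)%N ->
  coprime a n = sieve (primes n) a.
Proof.
move=> n0; apply/idP/allP => [can p | h].
  rewrite mem_primes => /and3P[pp _ pn]; apply/negP => pa.
  have : (p %| gcdn a n)%N by rewrite dvdn_gcd pa pn.
  by rewrite (eqP can) dvdn1 => /eqP p1; rewrite p1 in pp.
rewrite /coprime; apply/negPn/negP => g1.
have g0 : (0 < gcdn a n)%N by rewrite gcdn_gt0 n0 orbT.
have pr : prime (pdiv (gcdn a n)) by rewrite pdiv_prime // ltn_neqAle eq_sym g1.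
have pg := pdiv_dvd (gcdn a n).
have /h/negP[] : pdiv (gcdn a n) \in primes n.
  by rewrite mem_primes pr n0 (dvdn_trans pg (dvdn_gcdr _ _)).
exact: dvdn_trans pg (dvdn_gcdl _ _).
Qed.

(** [B] makes the count finite; the lemmas assume z < B, so that it cuts nothing off. *)
Definition sifted (R : realType) (B : nat) (ps : seq nat) (y z : R) : nat :=
  count (fun a => (y <= a%:R <= z) && sieve ps a) (iota 0 B).

Lemma sifted_nil (R : realType) (B : nat) (y z : R) : 0 <= y -> y <= z ->
  z < B%:R -> `|(sifted B [::] y z)%:R - (z - y)| <= 1.
Proof.
move=> y0 yz zB; have z0 := le_trans y0 yz.
set c := Num.truncn z; set d := Num.truncn y.
have /andP[c1 c2] := truncn_itv z0; have /andP[d1 d2] := truncn_itv y0.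
rewrite -/c -/d in c1 c2 d1 d2.
have cB : (c < B)%N by rewrite -(ltr_nat R); apply: le_lt_trans zB.
pose e := if d%:R == y then d else d.+1.
have eP a : (y <= a%:R :> R) = (e <= a)%N.
  rewrite /e; case: ifPn => [/eqP <-|dy]; first by rewrite ler_nat.
  apply/idP/idP => h; last by apply: ltW; apply: lt_le_trans d2 _; rewrite ler_nat.
  have : (d%:R : R) < y by rewrite lt_neqAle dy d1.
  by move=> /lt_le_trans/(_ h); rewrite ltr_nat.
have cP a : (a%:R <= z :> R) = (a < c.+1)%N.
  apply/idP/idP => h; last by apply: le_trans c1; rewrite ler_nat.
  by rewrite -(ltr_nat R); apply: le_lt_trans h c2.
have -> : sifted B [::] y z = (c.+1 - e)%N.
  rewrite /sifted (@eq_count _ _ (fun a => e <= a < c.+1)%N); last first.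
    by move=> a; rewrite eP cP /sieve /= andbT.
  rewrite -size_filter -(size_iota e (c.+1 - e)).
  apply/perm_size/uniq_perm; rewrite ?filter_uniq ?iota_uniq // => a.
  rewrite mem_filter !mem_iota /= add0n.
  by apply/idP/idP; lia.
have ec : (e <= c.+1)%N.
  have : (d <= c)%N by rewrite le_truncn.
  by rewrite /e; case: ifP => _; lia.
rewrite natrB // /e; case: ifPn => [/eqP dy|_]; rewrite ler_norml -?dy; apply/andP; split;
  move: c1 c2 d1 d2; rewrite -?dy -!natr1; lra.
Qed.

(** Legendre's recursion: the multiples p b of p in [y, z] correspond to the b in [y / p, z / p],
    and divisibility by the remaining primes does not see the factor p. *)
Lemma sifted_cons (R : realType) (B p : nat) (ps : seq nat) (y z : R) :
  prime p -> p \notin ps -> all prime ps -> z < B%:R ->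
  sifted B ps y z =
  (sifted B (p :: ps) y z + sifted B ps (y / p%:R) (z / p%:R))%N.
Proof.
move=> pp pps aps zB; have p0 := prime_gt0 pp.
have p0' : (0 : R) < p%:R by rewrite ltr0n.
pose P a := ((y <= a%:R <= z) && sieve ps a)%R.
rewrite /sifted.
have h : count P (iota 0 B) = (count (fun a => P a && ~~ (p %| a)) (iota 0 B) +
    count (fun a => P a && (p %| a)) (iota 0 B))%N.
  elim: (iota 0 B) => //= a s ->; case: (P a); case: (p %| a)%N => /=; lia.
rewrite h; congr (_ + _)%N.
  by apply: eq_count => a; rewrite /P /sieve /= -andbA; congr (_ && _); rewrite andbC.
rewrite -!size_filter -[RHS](size_map (fun b => p * b)%N).
apply/perm_size/uniq_perm; rewrite ?filter_uniq ?iota_uniq //.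
  rewrite map_inj_uniq ?filter_uniq ?iota_uniq // => a b /eqP.
  by rewrite eqn_pmul2l // => /eqP.
have sp b : sieve ps (p * b) = sieve ps b.
  apply: eq_in_all => q qps; have qp : prime q by apply: (allP aps).
  rewrite Euclid_dvdM // dvdn_prime2 //; case: eqP => // qe.
  by move: pps; rewrite -qe qps.
have yp b : (y <= (p * b)%:R <= z) = (y / p%:R <= b%:R <= z / p%:R).
  by rewrite natrM ler_pdivrMr // ler_pdivlMr // mulrC.
move=> a; rewrite mem_filter mem_iota /= add0n; apply/idP/mapP.
  move=> /andP[/andP[Pa /dvdnP[b ab]] aB]; exists b; last by rewrite ab mulnC.
  rewrite mulnC in ab; rewrite mem_filter mem_iota /= add0n.
  move: Pa; rewrite /P ab yp sp => -> /=.
  by apply: leq_ltn_trans aB; rewrite ab leq_pmull.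
move=> [b]; rewrite mem_filter mem_iota /= add0n => /andP[Pb bB] ->.
rewrite /P yp sp Pb dvdn_mulr //= -(ltr_nat R); apply: le_lt_trans zB.
by move: Pb => /andP[]; rewrite -yp => /andP[].
Qed.

(** For the primes of n this is phi(n) / n. *)
Definition density (R : realType) (ps : seq nat) : R :=
  \prod_(p <- ps) (1 - p%:R^-1).

(** Each prime replaces one count by a difference of two, so the error 1 of [sifted_nil] doubles
    with each prime. *)
Lemma sifted_bound (R : realType) (B : nat) (ps : seq nat) (y z : R) :
  uniq ps -> all prime ps -> 0 <= y -> y <= z -> z < B%:R ->
  `|(sifted B ps y z)%:R - (z - y) * density R ps| <= (2 ^ size ps)%:R.
Proof.
elim: ps y z => [|p ps IH] y z.
  by move=> *; rewrite /density big_nil mulr1; apply: sifted_nil.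
move=> /= /andP[pps ups] /andP[pp aps] y0 yz zB.
have p1 : (1 : R) <= p%:R by rewrite ler1n prime_gt0.
have p0 : (0 : R) < p%:R by rewrite ltr0n prime_gt0.
have h1 := IH _ _ ups aps y0 yz zB.
have yp0 : 0 <= y / p%:R by rewrite divr_ge0 // ltW.
have yzp : y / p%:R <= z / p%:R by rewrite ler_pM2r ?invr_gt0.
have zBp : z / p%:R < B%:R.
  by apply: le_lt_trans zB; rewrite ler_pdivrMr // ler_peMr // (le_trans y0).
have h2 := IH _ _ ups aps yp0 yzp zBp.
have := sifted_cons y pp pps aps zB.
move=> /(congr1 (fun n => n%:R : R)); rewrite natrD => h.
rewrite /density big_cons -/(density R ps) expnS natrM.
set S := (sifted B (p :: ps) y z)%:R in h *.
set D := density R ps in h1 h2 *.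
rewrite ler_norml; move: h1 h2; rewrite !ler_norml => /andP[a1 a2] /andP[b1 b2].
have e : (z - y) * ((1 - p%:R^-1) * D) = (z - y) * D - (z / p%:R - y / p%:R) * D.
  by ring.
rewrite e; apply/andP; split; lra.
Qed.

Lemma density_bounds (R : realType) (ps : seq nat) : all prime ps ->
  (2 ^ size ps)%:R^-1 <= density R ps <= 1.
Proof.
elim: ps => [|p ps IH] /=; first by rewrite /density big_nil expn0 invr1 lexx.
move=> /andP[pp /IH /andP[h1 h2]].
have p2 : (2 : R) <= p%:R by rewrite ler_nat prime_gt1.
have p0 : (0 : R) < p%:R by lra.
have : (p%:R^-1 : R) <= 2^-1 by rewrite lef_pV2 // ?posrE.
have : (0 : R) < p%:R^-1 by rewrite invr_gt0.
have h0 : (0 : R) < (2 ^ size ps)%:R^-1 by rewrite invr_gt0 ltr0n expn_gt0.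
rewrite /density big_cons -/(density R ps) expnS natrM invfM.
move: h1 h2; set q := p%:R^-1; set D := density R ps => h1 h2 q0 q2.
apply/andP; split; last by rewrite -[leRHS]mulr1 ler_pM //; lra.
by rewrite ler_pM //; lra.
Qed.

(** * Energy of the fractions with two given denominators *)

Definition harmonic_sum (R : realType) (m : nat) : R :=
  \sum_(i < m) i.+1%:R^-1.

Lemma harmonic_le (R : realType) (m m' : nat) : (m <= m')%N ->
  harmonic_sum R m <= harmonic_sum R m'.
Proof.
move=> mm'; rewrite /harmonic_sum -!(big_mkord xpredT (fun i => i.+1%:R^-1 : R)).
by rewrite [leRHS](@big_cat_nat _ _ _ m) //= lerDl sumr_ge0.
Qed.

Lemma harmonic_pow2 (R : realType) (k : nat) : harmonic_sum R (2 ^ k) <= k.+1%:R.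
Proof.
elim: k => [|k IH]; first by rewrite /harmonic_sum expn0 big_ord1 invr1.
rewrite /harmonic_sum -!(big_mkord xpredT (fun i => i.+1%:R^-1 : R)).
have h2 : (2 ^ k <= 2 ^ k.+1)%N by rewrite leq_pexp2l.
rewrite (@big_cat_nat _ _ _ (2 ^ k)) //= -[leRHS]natr1 lerD //.
  by move: IH; rewrite /harmonic_sum big_mkord.
have e : (1 : R) = \sum_(2 ^ k <= i < 2 ^ k.+1) (2 ^ k)%:R^-1.
  by rewrite sumr_const_nat expnS mul2n -addnn addnK -[RHS]mulr_natr mulVf //.
rewrite [leRHS]e big_nat_cond [leRHS]big_nat_cond ler_sum // => i /andP[/andP[h _] _].
by rewrite lef_pV2 ?posrE ?ltr0n ?expn_gt0 // ler_nat ltnW.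
Qed.

(** Since (a - b) q' = (a' - b') q, the numbers a and b agree modulo q as well as in their quotient
    by q. *)
Lemma cross_eq_inj (q q' a a' b b' : nat) : (0 < q)%N -> coprime q q' ->
  (a * q' + b' * q = b * q' + a' * q)%N -> (a %/ q = b %/ q)%N -> a = b.
Proof.
move=> q0 qq'; wlog ab : a b a' b' / (a <= b)%N => [hw|] e d.
  have [ab|ba] := leqP a b; first exact: (hw a b a' b').
  by apply/esym/(hw b a b' a') => //; apply: ltnW.
have : (q %| (b - a) * q')%N.
  apply/dvdnP; exists (b' - a')%N; rewrite !mulnBl; nia.
rewrite Gauss_dvdl // => /dvdnP[c bc].
have {}bc : (b = c * q + a)%N by lia.
by move: d; rewrite bc divnMDl //; lia.
Qed.

(* With g = gcd n n', each nonzero value of |a n' - a' n| is a multiple m g and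
   is taken with either sign by at most g pairs: the quotient of a by n / g
   distinguishes them. *)
Lemma cross_energy (R : realType) (n n' : nat) : (0 < n)%N -> (0 < n')%N ->
  \sum_(x : 'I_n * 'I_n' | (x.1 * n' != x.2 * n)%N)
    (`|(x.1 * n')%N - (x.2 * n)%N|%N%:R)^-1 <= 2 * harmonic_sum R (n * n').
Proof.
move=> n0 n'0; pose g := gcdn n n'.
have g0 : (0 < g)%N by rewrite gcdn_gt0 n0.
pose q := (n %/ g)%N; pose q' := (n' %/ g)%N.
have nE : n = (q * g)%N by rewrite divnK // dvdn_gcdl.
have n'E : n' = (q' * g)%N by rewrite divnK // dvdn_gcdr.
have q0 : (0 < q)%N by rewrite divn_gt0 // dvdn_leq ?dvdn_gcdl.
have cqq' : coprime q q'.
  rewrite /coprime -(eqn_pmul2r g0) mul1n muln_gcdl -nE -n'E.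
  exact: eqxx.
pose D (x : 'I_n * 'I_n') := (`|(x.1 * q')%N - (x.2 * q)%N|)%N.
have DE (x : 'I_n * 'I_n') :
    (`|(x.1 * n')%N - (x.2 * n)%N|)%N = (D x * g)%N.
  rewrite /D; case: x => x x' /=; move: (nat_of_ord x) (nat_of_ord x') => a a'.
  by rewrite nE n'E; nia.
have Dlt (x : 'I_n * 'I_n') : ((D x).-1 < n * n')%N.
  case: x => x x'; have := ltn_ord x; have := ltn_ord x'; rewrite /D /=.
  move: (nat_of_ord x) (nat_of_ord x') => a a' h h'.
  have : (q <= n)%N by rewrite nE leq_pmulr.
  have : (q' <= n')%N by rewrite n'E leq_pmulr.
  by nia.
have ilt (x : 'I_n * 'I_n') : (x.1 %/ q < g)%N.
  by rewrite ltn_divLR // mulnC -nE.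
pose phi (x : 'I_n * 'I_n') : bool * 'I_(n * n') * 'I_g :=
  ((x.1 * q' < x.2 * q)%N, Ordinal (Dlt x), Ordinal (ilt x)).
pose A := finset (fun x : 'I_n * 'I_n' => (x.1 * n' != x.2 * n)%N).
pose F (y : bool * 'I_(n * n') * 'I_g) : R := (y.1.2.+1%:R * g%:R)^-1.
have inA x : x \in A -> (0 < D x)%N.
  rewrite inE => h; rewrite lt0n; apply: contra_neq h => h.
  have := DE x; rewrite h mul0n; lia.
rewrite (eq_bigl (mem A)); last by move=> x; rewrite !inE.
rewrite (eq_bigr (fun x => F (phi x))); last first.
  by move=> x xA; rewrite DE natrM /F /= prednK // inA.
rewrite -(big_imset (fun y => F y)) /=; last first.
  move=> x y xA yA [] e1 e2 e3.
  have dx := inA x xA; have dy := inA y yA.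
  move: xA yA; rewrite !inE => xA yA.
  have e : (x.1 * q' + y.2 * q = y.1 * q' + x.2 * q)%N.
    by move: e1 e2 dx dy; rewrite /D; lia.
  have e4 := cross_eq_inj q0 cqq' e e3.
  move: e; rewrite e4 => /addnI/eqP; rewrite eqn_pmul2r // => /eqP e5.
  case: x y e4 e5 {e1 e2 e3 dx dy xA yA} => x x' [y y'] /= e4 e5.
  by congr pair; apply: val_inj.
apply: (@le_trans _ _ (\sum_y F y)).
  rewrite [leRHS](bigID (mem (imset phi (mem A)))) /= lerDl.
  by apply: sumr_ge0 => y _; rewrite invr_ge0 mulr_ge0.
rewrite -(pair_bigA _ (fun y i => F (y, i))) /=.
rewrite (eq_bigr (fun y : bool * 'I_(n * n') => y.2.+1%:R^-1)); last first.
  move=> y _; rewrite /F /= sumr_const card_ord -[LHS]mulr_natr invfM -mulrA.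
  by rewrite mulVf ?mulr1 // pnatr_eq0 -lt0n.
rewrite -(pair_bigA _ (fun (_ : bool) (i : 'I_(n * n')) => i.+1%:R^-1)) /=.
by rewrite sumr_const card_bool -/(harmonic_sum R (n * n')) mulr_natl.
Qed.

(** * Extracting a large dyadic class from the divergent series *)

Lemma totient_le (n : nat) : (totient n <= n)%N.
Proof.
rewrite totient_count_coprime -[leqRHS]subn0 -[leqRHS]muln1 -sum_nat_const_nat.
by apply: leq_sum => i _; rewrite leq_b1.
Qed.

(** In the application u n is psi n / n, and the class supplies the set A with r = 2^-(j+1). *)
Definition rich_class (R : realType) (u : nat -> R) (k j : nat) : seq nat :=
  [seq n <- iota (2 ^ k) (2 ^ k) | 2^-1 ^+ j.+1 < u n].

Lemma expr_eventually_le (R : realType) (q e : R) : 0 <= q -> q < 1 -> 0 < e ->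
  exists k0, forall k, (k0 <= k)%N -> q ^+ k <= e.
Proof.
move=> q0 q1 e0.
have /cvgrPdist_le/(_ _ e0)[k0 _ h] : (GRing.exp q : R^nat) @ \oo --> (0 : R).
  by apply: cvg_expr; rewrite ger0_norm.
by exists k0 => k /h; rewrite sub0r normrN ger0_norm // exprn_ge0.
Qed.

Lemma gt1_powR_lt (R : realType) (a x y : R) : 1 < a -> x < y ->
  a `^ x < a `^ y.
Proof.
move=> a1 xy; have a0 : 0 < a by apply: lt_trans a1.
by rewrite /powR !gt_eqF // ltr_expR ltr_pM2r // ln_gt0.
Qed.

Lemma powR_half (R : realType) (s : R) : 2^-1 `^ s = 2 `^ (- s) :> R.
Proof. by rewrite -powR_inv1 // -powRrM mulN1r. Qed.

Lemma dyadic_ratio_lt1 (R : realType) (s0 s : R) : s0 < s ->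
  2 `^ s0 * 2^-1 `^ s < 1 :> R.
Proof.
move=> s0s; rewrite powR_half -powRD ?pnatr_eq0 ?implybT //.
by rewrite -[ltRHS](powRr0 2) gt1_powR_lt ?ltr1n // subr_lt0.
Qed.

(** The term of the level j with 2^-(j+1) < x <= 2^-j already bounds x^s. Admitting all deeper
    levels makes the condition on j one-sided, so that exchanging sums over n and j counts the
    elements of [rich_class]. *)
Lemma dyadic_powR_le (R : realType) (x s : R) (k J : nat) : 0 <= s ->
  0 <= x -> x <= 2^-1 ^+ k -> (2^-1 ^+ J < x) ->
  x `^ s <= \sum_(k <= j < J | 2^-1 ^+ j.+1 < x) (2^-1 `^ s) ^+ j.
Proof.
move=> s0 x0 xk; have h0 : (0 : R) <= 2^-1 by rewrite invr_ge0.
elim: J => [|J IH] xJ.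
  move: (lt_le_trans xJ xk); rewrite expr0 => h.
  have : (2^-1 ^+ k <= 1 :> R) by rewrite exprn_ile1 // invf_le1 // ler1n.
  by move=> /(lt_le_trans h); rewrite ltxx.
have kJ : (k <= J)%N.
  rewrite leqNgt; apply/negP => Jk; move: (lt_le_trans xJ xk).
  rewrite ltNge ler_wiXn2l // invf_le1 // ler1n //.
rewrite big_mkcond big_nat_recr //= xJ -big_mkcond /=.
have [h|h] := ltP (2^-1 ^+ J) x.
  by apply: le_trans (IH h) _; rewrite lerDl exprn_ge0 // powR_ge0.
apply: (@le_trans _ _ ((2^-1 `^ s) ^+ J)).
  rewrite -powR_mulrn ?powR_ge0 // -powRrM mulrC powRrM powR_mulrn //.
  by apply: ge0_ler_powR; rewrite // nnegrE exprn_ge0.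
by rewrite lerDr sumr_ge0 // => j _; rewrite exprn_ge0 // powR_ge0.
Qed.

(** Lets the dyadic decomposition stop at one level J for a whole block; the n with u n = 0 are
    exempt, as they contribute 0 to the series. *)
Lemma exists_dyadic_below (R : realType) (u : nat -> R) (s : seq nat) :
  exists J0, forall J, (J0 <= J)%N -> forall n, n \in s -> 0 < u n ->
    2^-1 ^+ J < u n.
Proof.
elim: s => [|m s [J0 IH]]; first by exists 0%N.
have [um|um] := ltP 0 (u m); last first.
  exists J0 => J hJ n; rewrite inE => /orP[/eqP ->|ns]; last exact: IH.
  by rewrite ltNge um.
have := @expr_eventually_le R 2^-1 (u m / 2).
have h1 : (2^-1 : R) < 1 by rewrite invf_lt1 // ltr1n.
rewrite invr_ge0 ler0n divr_gt0 // => /(_ isT h1 isT)[J1 h].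
exists (maxn J0 J1) => J; rewrite geq_max => /andP[j0 j1] n.
rewrite inE => /orP[/eqP -> _|ns]; last exact: IH.
by apply: le_lt_trans (h _ j1) _; lra.
Qed.

Lemma geometric_le (R : realType) (q : R) (k J : nat) : 0 <= q -> q < 1 ->
  \sum_(k <= j < J) q ^+ j <= q ^+ k / (1 - q).
Proof.
move=> q0 q1; have q1' : 0 < 1 - q by rewrite subr_gt0.
have [Jk|kJ] := leqP J k.
  by rewrite big_geq // divr_ge0 ?exprn_ge0 // ltW.
rewrite ler_pdivlMr // mulrC mulr_sumr.
rewrite (eq_bigr (fun j => - q ^+ j.+1 - - q ^+ j)); last by move=> j _; rewrite exprS; ring.
rewrite telescope_sumr; last exact: ltnW.
by have := exprn_ge0 J q0; lra.
Qed.

(** Level j has fewer than (2^s0)^(j+1) / 2^k indices, each contributing at most 2^(k+1) 2^(-j s),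
    so the levels form a geometric series of ratio q. The factor 4 collects phi(n) <= 2 * 2^k and
    the shift from j + 1 to j. *)
Lemma block_sum_le (R : realType) (u : nat -> R) (s0 s q : R) (k : nat) :
  (forall n, (1 <= n)%N -> 0 <= u n) -> 0 <= s0 -> s0 < s -> s < 1 ->
  (2 `^ s0) ^+ k.+1 <= 2 ^+ k ->
  (forall j, (k <= j)%N ->
    (size (rich_class u k j) * 2 ^ k)%:R < (2 `^ s0) ^+ j.+1) ->
  q = 2 `^ s0 * 2^-1 `^ s ->
  \sum_(2 ^ k <= n < 2 ^ k.+1) u n `^ s * (totient n)%:R <= 4 / (1 - q) * q ^+ k.
Proof.
move=> u0 s00 s0s s1 hk poor qE.
have v2 : 2 `^ s0 <= 2 :> R.
  by rewrite -[leRHS]powRr1 // ler_powR ?ler1n //; lra.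
have v0 : 0 < 2 `^ s0 :> R by rewrite powR_gt0.
have t0 : 0 < 2^-1 `^ s :> R by rewrite powR_gt0 // invr_gt0.
have q0 : 0 <= q by rewrite qE mulr_ge0 // ltW.
have q1 : q < 1 by rewrite qE dyadic_ratio_lt1.
have inb n : (2 ^ k <= n < 2 ^ k.+1)%N = (n \in iota (2 ^ k) (2 ^ k)).
  by rewrite mem_iota expnS mul2n addnn.
(* A larger value would put n in the class of level k, and by the size condition on k a single
   element is already too many for a poor class. *)
have uk n : (2 ^ k <= n < 2 ^ k.+1)%N -> u n <= 2^-1 ^+ k.
  move=> hn; rewrite leNgt; apply/negP => h.
  have := poor k (leqnn k); apply/negP; rewrite -leNgt (le_trans hk) //.
  rewrite -natrX ler_nat leq_pmull // -has_predT; apply/hasP; exists n => //.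
  rewrite mem_filter -inb hn andbT (le_lt_trans _ h) // exprS ler_piMl //.
  by rewrite invf_le1 // ler1n.
have [J hJ] := exists_dyadic_below u (iota (2 ^ k) (2 ^ k)).
apply: (@le_trans _ _ (\sum_(2 ^ k <= n < 2 ^ k.+1)
   \sum_(k <= j < J | 2^-1 ^+ j.+1 < u n) (2 ^ k.+1)%:R * (2^-1 `^ s) ^+ j)).
  rewrite big_nat_cond [leRHS]big_nat_cond; apply: ler_sum => n /andP[hn _].
  have n0 : (0 < n)%N by apply: leq_trans (proj1 (andP hn)); rewrite expn_gt0.
  rewrite -mulr_sumr mulrC; apply: ler_pM; rewrite ?powR_ge0 //.
    rewrite ler_nat; apply: leq_trans (ltnW (proj2 (andP hn))).
    exact: totient_le.
  have := u0 n n0; rewrite le_eqVlt => /orP[/eqP <-|un].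
    have sn0 : s != 0 by lra.
    by rewrite powR0 //; apply: sumr_ge0 => j _; rewrite exprn_ge0 // ltW.
  apply: dyadic_powR_le; rewrite ?u0 ?uk ?(hJ J) -?inb //; lra.
rewrite (exchange_big_dep_nat xpredT) //=.
apply: (@le_trans _ _ (\sum_(k <= j < J) 4 * q ^+ j)); last first.
  rewrite -mulr_sumr -mulrA ler_pM2l // mulrC.
  exact: geometric_le.
rewrite big_nat_cond [leRHS]big_nat_cond; apply: ler_sum => j /andP[/andP[kj _] _].
rewrite -mulr_sumr.
have -> : \sum_(2 ^ k <= n < 2 ^ k.+1 | 2^-1 ^+ j.+1 < u n) (2^-1 `^ s) ^+ j =
  (size (rich_class u k j))%:R * (2^-1 `^ s) ^+ j.
  rewrite /rich_class size_filter /index_iota expnS mul2n -addnn addnK.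
  by rewrite big_const_seq iter_addr_0 mulr_natl.
have := ltW (poor j kj); rewrite natrM => h.
rewrite qE exprMn expnS natrM.
have vj : (2 `^ s0) ^+ j.+1 <= 2 * (2 `^ s0) ^+ j.
  by rewrite exprS ler_wpM2r // exprn_ge0 // ltW.
have tj : 0 <= (2^-1 `^ s) ^+ j :> R by rewrite exprn_ge0 // ltW.
move: h vj tj; set S := (size _)%:R; set T := (2^-1 `^ s) ^+ j.
move=> h vj tj.
have := ler_wpM2r tj (le_trans h vj); lra.
Qed.

(** If all classes with k >= [k0] were poor, [block_sum_le] would bound the tail of the series by a
    convergent geometric series. *)
Lemma exists_rich_class (R : realType) (u : nat -> R) (s0 s : R) (k0 : nat) :
  (forall n, (1 <= n)%N -> 0 <= u n) -> 0 <= s0 -> s0 < s -> s < 1 ->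
  (\sum_(1 <= n <oo) (u n `^ s * (totient n)%:R)%:E)%E = +oo%E ->
  exists k j : nat, [/\ (k0 <= k)%N, (k <= j)%N &
    (2 `^ s0) ^+ j.+1 <= (size (rich_class u k j) * 2 ^ k)%:R].
Proof.
move=> u0 s00 s0s s1 sdiv; apply/not_existsP => hno.
have v0 : 0 < 2 `^ s0 :> R by rewrite powR_gt0.
have v2 : 2 `^ s0 < 2 :> R.
  by rewrite -[ltRHS]powRr1 // gt1_powR_lt ?ltr1n //; lra.
(* The size condition of [block_sum_le], divided by 2^k and by 2^s0. *)
have [k1 hk1] : exists k1, forall k, (k1 <= k)%N -> (2 `^ s0 / 2) ^+ k <= (2 `^ s0)^-1 :> R.
  apply: expr_eventually_le; rewrite ?invr_gt0 ?divr_ge0 // ?ltW //.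
  by rewrite ltr_pdivrMr // mul1r.
pose K := maxn k0 k1.
pose q : R := 2 `^ s0 * 2^-1 `^ s.
have q0 : 0 <= q by rewrite mulr_ge0 // powR_ge0.
have q1 : q < 1 by exact: dyadic_ratio_lt1.
have hb k : (K <= k)%N -> \sum_(2 ^ k <= n < 2 ^ k.+1) u n `^ s * (totient n)%:R
    <= 4 / (1 - q) * q ^+ k.
  rewrite geq_max => /andP[k0k k1k]; apply: (@block_sum_le _ _ s0 s) => //.
    have := hk1 k k1k; rewrite exprMn exprVn ler_pdivrMr ?exprn_gt0 //.
    by rewrite [_^-1 * _]mulrC ler_pdivlMr // -exprSr.
  move=> j kj; rewrite ltNge; apply/negP => h.
  by apply: (hno k); exists j.
pose f n : R := u n `^ s * (totient n)%:R.
have f0 n : 0 <= f n by rewrite mulr_ge0 ?powR_ge0.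
pose C := \sum_(1 <= n < 2 ^ K) f n + 4 / (1 - q) * (q ^+ K / (1 - q)).
have hC k : (K <= k)%N -> \sum_(1 <= n < 2 ^ k) f n <= C.
  move=> Kk; rewrite (@big_cat_nat _ _ _ (2 ^ K)) ?expn_gt0 ?leq_pexp2l //=.
  rewrite lerD2l; apply: (@le_trans _ _ (\sum_(K <= i < k) 4 / (1 - q) * q ^+ i)).
    elim: k Kk => [|k IH]; first by rewrite leqn0 => /eqP ->; rewrite !big_geq.
    rewrite leq_eqVlt => /orP[/eqP ->|]; first by rewrite !big_geq.
    rewrite ltnS => Kk; rewrite big_nat_recr //=.
    rewrite (@big_cat_nat _ _ _ (2 ^ k)) ?leq_pexp2l //=.
    by apply: lerD; [exact: IH|exact: hb].
  rewrite -mulr_sumr; apply: ler_wpM2l; last exact: geometric_le.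
  by rewrite divr_ge0 // subr_ge0 ltW.
suff : (\sum_(1 <= n <oo) (f n)%:E <= C%:E)%E by rewrite sdiv.
apply: lime_le; first by apply: is_cvg_nneseries => n _ _; rewrite lee_fin.
exists K => // n /= Kn; rewrite sumEFin lee_fin; apply: le_trans (hC n Kn).
have [n0|n0] := leqP n 1; first by rewrite big_geq // sumr_ge0.
rewrite [leRHS](@big_cat_nat _ _ _ n) ?(ltnW (ltn_expl _ _)) ?(ltnW n0) //=.
by rewrite lerDl sumr_ge0.
Qed.

(** * Spacing and distribution of the fractions with denominators in A *)

Definition frac (R : realType) (p : nat * nat) : R := p.1%:R / p.2%:R.

Definition fractions (A : seq nat) : seq (nat * nat) :=
  [seq (a, n) | n <- A, a <- iota 0 n].

Lemma mem_fractions (A : seq nat) (p : nat * nat) :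
  (p \in fractions A) = (p.2 \in A) && (p.1 < p.2)%N.
Proof.
apply/idP/idP.
  by move=> /allpairsPdep[n [a [nA]]]; rewrite mem_iota => /andP[_ an] -> /=; rewrite nA.
move=> /andP[h1 h2]; apply/allpairsPdep; exists p.2, p.1; split => //.
  by rewrite mem_iota.
by case: p h1 h2.
Qed.

Lemma fractions_uniq (A : seq nat) : uniq A -> uniq (fractions A).
Proof.
move=> uA; apply: allpairs_uniq_dep => //.
  by move=> n _; rewrite iota_uniq.
by move=> [n a] [n' a'] _ _ /= [-> ->].
Qed.

Lemma frac_inj (R : realType) (p q : nat * nat) : (0 < p.2)%N -> (0 < q.2)%N ->
  coprime p.1 p.2 -> coprime q.1 q.2 -> frac R p = frac R q -> p = q.
Proof.
case: p q => [a n] [a' n'] /= n0 n'0 cp cq.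
rewrite /frac /= => /eqP; rewrite eqr_div ?pnatr_eq0 -?lt0n // -!natrM eqr_nat.
move=> /eqP e.
have nn' : n = n'.
  apply/eqP; rewrite eqn_dvd.
  have -> : (n %| n')%N.
    by rewrite -(@Gauss_dvdr n a) 1?coprime_sym // e dvdn_mull.
  by rewrite -(@Gauss_dvdr n' a') 1?coprime_sym // -e dvdn_mull.
by move: e; rewrite nn' => /eqP; rewrite eqn_pmul2r // => /eqP ->.
Qed.

Lemma frac_dist (R : realType) (a n a' n' : nat) : (0 < n)%N -> (0 < n')%N ->
  `|frac R (a, n) - frac R (a', n')| =
  (`|(a * n')%N - (a' * n)%N|%N%:R) / (n * n')%:R.
Proof.
move=> n0 n'0; have nr : (0 : R) < n%:R by rewrite ltr0n.
have nr' : (0 : R) < n'%:R by rewrite ltr0n.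
rewrite natr_absz intr_norm rmorphB /= !pmulrn -!pmulrn !natrM.
have -> : frac R (a, n) - frac R (a', n') =
    (a%:R * n'%:R - a'%:R * n%:R) / (n%:R * n'%:R).
  by rewrite /frac /=; field; rewrite !gt_eqF.
by rewrite normrM normfV (ger0_norm (_ : 0 <= n%:R * n'%:R)) // mulr_ge0.
Qed.

(** As |a/n - a'/n'| = |a n' - a' n| / (n n'), [cross_energy] applies to each pair of denominators.
    With N = |A| 2^k the bound exceeds N^2 by a factor linear in k. Unreduced fractions are
    included: dropping them later only decreases the sum. *)
Lemma fractions_energy (R : realType) (A : seq nat) (k : nat) :
  (forall n, n \in A -> (2 ^ k <= n < 2 ^ k.+1)%N) ->
  \sum_(p <- fractions A) \sum_(q <- fractions A | frac R q != frac R p)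
    `|frac R p - frac R q|^-1
  <= (8 * (2 * k + 3) * (size A * 2 ^ k) ^ 2)%:R.
Proof.
move=> hA; rewrite /fractions big_allpairs_dep /=.
have hn n : n \in A -> (0 < n)%N.
  by move=> /hA /andP[+ _]; apply: leq_trans; rewrite expn_gt0.
pose c : R := (8 * (2 * k + 3) * (2 ^ k) ^ 2)%:R.
have -> : (8 * (2 * k + 3) * (size A * 2 ^ k) ^ 2)%:R =
    \sum_(n <- A) \sum_(n' <- A) c.
  rewrite !big_const_seq !count_predT !iter_addr_0 -mulrnA -[RHS]mulr_natr.
  by rewrite /c -natrM; congr _%:R; ring.
rewrite big_seq_cond [leRHS]big_seq_cond; apply: ler_sum => n /andP[nA _].
under eq_bigr do rewrite big_mkcond big_allpairs_dep /=.
rewrite exchange_big /= big_seq_cond [leRHS]big_seq_cond.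
apply: ler_sum => n' /andP[n'A _].
have n0 := hn n nA; have n'0 := hn n' n'A.
apply: (@le_trans _ _ ((n * n')%:R * (2 * harmonic_sum R (n * n')))); last first.
  have /andP[h1 h2] := hA n nA; have /andP[h1' h2'] := hA n' n'A.
  have h : (n * n' <= 2 ^ (2 * k + 2))%N.
    rewrite (_ : 2 * k + 2 = k.+1 + k.+1)%N; last lia.
    by rewrite expnD leq_mul // ltnW.
  have hH : harmonic_sum R (n * n') <= (2 * k + 3)%:R.
    apply: le_trans (harmonic_le R h) _; apply: le_trans (harmonic_pow2 R _) _.
    by rewrite ler_nat; lia.
  have hH0 : 0 <= harmonic_sum R (n * n').
    by apply: sumr_ge0 => i _; rewrite invr_ge0.
  apply: (@le_trans _ _ ((2 ^ (2 * k + 2))%:R * (2 * (2 * k + 3)%:R))).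
    by apply: ler_pM; rewrite ?mulr_ge0 ?ler_nat // ler_wpM2l.
  rewrite /c -natrM -natrM ler_nat expnD mulnC (mulnC 2 k) expnM.
  by rewrite (_ : 2 ^ 2 = 4)%N //; nia.
rewrite -ler_pdivrMl ?ltr0n ?muln_gt0 ?n0 //.
apply: le_trans (cross_energy R n0 n'0).
have iotaE m : iota 0 m = index_iota 0 m by rewrite /index_iota subn0.
rewrite iotaE big_mkord mulr_sumr.
rewrite [leRHS]big_mkcond -(pair_bigA _ (fun (a : 'I_n) (a' : 'I_n') =>
  if (a * n' != a' * n)%N then (`|(a * n')%N - (a' * n)%N|%N%:R)^-1 else 0)) /=.
apply: ler_sum => a _.
rewrite iotaE big_mkord mulr_sumr.
apply: ler_sum => a' _.
case: ifPn => h; last by rewrite mulr0; case: ifP.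
rewrite frac_dist // invf_div mulrA mulVf ?mul1r; last first.
  by rewrite pnatr_eq0 -lt0n muln_gt0 n0.
rewrite ifT //; apply: contra_neq h => h; apply/eqP.
by rewrite /frac /= eqr_div ?pnatr_eq0 -?lt0n // -!natrM h.
Qed.

Definition fcount (R : realType) (A : seq nat) (y z : R) : nat :=
  count (fun q => (y <= frac R q <= z) && coprime q.1 q.2) (fractions A).

(** The sum of phi(n) over A, that is, the expected number of reduced fractions per unit length. *)
Definition mass (R : realType) (A : seq nat) : R :=
  \sum_(n <- A) n%:R * density R (primes n).

Lemma fcount_bound (R : realType) (A : seq nat) (y z : R) :
  (forall n, n \in A -> (0 < n)%N) -> 0 <= y -> y <= z -> z < 1 ->
  `|(fcount A y z)%:R - (z - y) * mass R A| <=
  \sum_(n <- A) (2 ^ size (primes n))%:R.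
Proof.
move=> hA y0 yz z1; rewrite /fcount -sum1_count /fractions big_mkcond.
rewrite big_allpairs_dep /= natr_sum mulr_sumr -sumrB.
apply: le_trans (ler_norm_sum _ _ _) _.
rewrite big_seq_cond [leRHS]big_seq_cond; apply: ler_sum => n /andP[nA _].
have n0 := hA n nA; have n0' : (0 : R) < n%:R by rewrite ltr0n.
have := @sifted_bound R n (primes n) (n%:R * y) (n%:R * z).
move=> /(_ (primes_uniq n)) h.
have : `|(sifted n (primes n) (n%:R * y) (n%:R * z))%:R -
    (n%:R * z - n%:R * y) * density R (primes n)| <= (2 ^ size (primes n))%:R.
  apply: h; rewrite ?mulr_ge0 ?ler_pM2l ?gtr_pMr //.
  by apply/allP => p; rewrite mem_primes => /and3P[].
congr (`| _%:R - _| <= _); last by ring.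
rewrite -big_mkcond sum1_count; apply: eq_count => a /=.
by rewrite coprime_sieve // /frac /= ler_pdivlMr // ler_pdivrMr // !(mulrC n%:R).
Qed.

(** Every q with 0 < |v q - c| <= d contributes at least 1 / d to the sum. *)
Lemma count_le_energy (R : realType) (T : eqType) (v : T -> R) (Q : seq T) (c d : R) :
  0 <= d ->
  (count (fun q => `|v q - c| <= d) Q)%:R <=
  (count (fun q => v q == c) Q)%:R +
  d * \sum_(q <- Q | v q != c) `|c - v q|^-1.
Proof.
move=> d0; elim: Q => [|q Q IH] /=; first by rewrite big_nil mulr0 addr0.
rewrite big_cons !natrD; case: eqP => [->|/eqP vc] /=.
  by rewrite -addrA lerD // lern1 leq_b1.
rewrite mulrDr add0r [leRHS]addrCA; apply: lerD => //.
have h0 : 0 < `|c - v q| by rewrite normr_gt0 subr_eq0 eq_sym.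
rewrite distrC; case: (lerP _ d) => h; first by rewrite ler_pdivlMr // mul1r.
by rewrite divr_ge0 // ltW.
Qed.

(** Markov's inequality: at most half of the terms exceed twice the bound M / |Q| of their mean. *)
Lemma count_average_le (R : realType) (T : eqType) (e : T -> R) (Q : seq T) (M : R) :
  (forall q, 0 <= e q) -> 0 < M -> \sum_(q <- Q) e q <= M ->
  (size Q <= 2 * count (fun q => e q * (size Q)%:R <= 2 * M)%R Q)%N.
Proof.
move=> e0 M0 hM; set P := fun q => _; have := count_predC P Q => hc.
set n := size Q in P hc *.
have h : (2 * M) * (count (predC P) Q)%:R <= M * n%:R.
  apply: (@le_trans _ _ ((\sum_(q <- Q) e q) * n%:R)); last by rewrite ler_wpM2r.
  rewrite mulr_suml -sum1_count natr_sum mulr_sumr [leRHS](bigID (predC P)) /=.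
  rewrite -[leLHS]addr0; apply: lerD; last by apply: sumr_ge0 => q _; rewrite mulr_ge0.
  apply: ler_sum => q; rewrite mulr1 /P -ltNge; exact: ltW.
have : 2 * (count (predC P) Q)%:R <= n%:R :> R.
  by rewrite -(ler_pM2l M0) mulrA [M * 2]mulrC.
rewrite -natrM ler_nat; lia.
Qed.

(* The hypotheses bundle the asymptotics: X is a small power of 2 ^ k that
   dominates every constant and logarithm of the estimates. *)
Lemma good_fractions (R : realType) (A : seq nat) (k : nat) (X r l kap s x : R) :
  uniq A -> (forall n, n \in A -> (2 ^ k <= n < 2 ^ k.+1)%N) ->
  (forall n, n \in A -> (2 ^ size (primes n))%:R <= X) ->
  0 < s -> s < 1 -> 96 <= X -> (8 * (2 * k + 3))%:R <= X ->
  0 < l -> 1 <= l * X -> 0 < kap -> kap <= 1 -> 1 <= kap * X ->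
  X ^+ 4 <= (2 ^ k)%:R -> 0 < r -> r <= X ^+ 2 / (2 ^ k)%:R ->
  X ^+ 4 <= (size A * 2 ^ k)%:R * r `^ s ->
  X ^+ 8 * (X ^+ 2 / (2 ^ k)%:R) `^ (1 - s) <= 1 ->
  0 <= x - l -> x + l <= 1 ->
  exists P : seq (nat * nat), [/\ (0 < size P)%N,
    forall p, p \in P -> [/\ p.2 \in A, coprime p.1 p.2, (p.1 < p.2)%N &
      `|frac R p - x| <= l / 2],
    forall p, p \in P -> forall rho, r <= rho ->
      (count (fun q => `|frac R q - frac R p| <= 3 * rho) P)%:R <=
      28 * (size P)%:R * (rho / l) `^ s &
    forall p, p \in P ->
      (count (fun q => `|frac R q - frac R p| <= 3 * r) P)%:R <=
      kap * (size P)%:R * r `^ s].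
Proof.
move=> uA hA hX s0 s1 X96 Xk l0 lX kap0 kap1 kapX XK r0 rK XN X8 x0 x1.
have X0 : 0 < X by lra.
have l1 : l <= 1 by lra.
set K : R := (2 ^ k)%:R in XK rK X8.
have K0 : 0 < K by rewrite ltr0n expn_gt0.
set a : R := (size A)%:R.
have NE : (size A * 2 ^ k)%:R = a * K :> R by rewrite natrM.
rewrite NE in XN; set N := a * K in NE XN.
have a0 : 0 <= a by rewrite ler0n.
have N0 : 0 < N.
  have rs0 : 0 < r `^ s by rewrite powR_gt0.
  by rewrite -(pmulr_lgt0 _ rs0); apply: lt_le_trans XN; rewrite exprn_gt0.
have An n : n \in A -> (0 < n)%N.
  by move=> /hA /andP[+ _]; apply: leq_trans; rewrite expn_gt0.
pose y := x - l / 2; pose z := x + l / 2.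
pose Q := [seq p <- fractions A | (y <= frac R p <= z) && coprime p.1 p.2].
have sQ : size Q = fcount A y z by rewrite size_filter.
pose T : R := mass R A.
have omegaA : \sum_(n <- A) (2 ^ size (primes n))%:R <= a * X.
  rewrite /a -sum1_size natr_sum mulr_suml big_seq_cond [leRHS]big_seq_cond.
  by apply: ler_sum => n /andP[nA _]; rewrite mul1r hX.
have TN : N <= T * X.
  rewrite /T /mass /N /a -sum1_size natr_sum !mulr_suml big_seq_cond [leRHS]big_seq_cond.
  apply: ler_sum => n /andP[nA _]; rewrite mul1r.
  have ap : all prime (primes n) by apply/allP => p; rewrite mem_primes => /and3P[].
  have /andP[d1 _] := density_bounds R ap.
  have Kn : K <= n%:R by rewrite ler_nat; have /andP[] := hA n nA.
  have om0 : (0 : R) < (2 ^ size (primes n))%:R by rewrite ltr0n expn_gt0.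
  apply: (le_trans Kn); rewrite -mulrA ler_peMr //.
  rewrite -(mulVf (lt0r_neq0 om0)); apply: ler_pM => //; last exact: hX.
(* The main term T of the sieve beats its error a X by a factor X^2, since T >= N / X and N = a K
   with K >= X^4. *)
have aT : X ^+ 3 * a <= T.
  rewrite -(ler_pM2r X0); apply: le_trans TN.
  have : X ^+ 4 * a <= K * a by rewrite ler_wpM2r.
  by rewrite /N; lra.
have T0 : 0 <= T by apply: le_trans aT; rewrite mulr_ge0 ?exprn_ge0 // ltW.
have aX2 : a * X * 2 <= l * T.
  have h1 : l * (X ^+ 3 * a) <= l * T by rewrite ler_wpM2l // ltW.
  have h2 : 1 * (X ^+ 2 * a) <= l * X * (X ^+ 2 * a).
    by rewrite ler_wpM2r // mulr_ge0 // exprn_ge0 // ltW.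
  have Xa : 0 <= X * a by rewrite mulr_ge0 // ltW.
  have h3 : 2 * (X * a) <= X * (X * a) by rewrite ler_wpM2r //; lra.
  lra.
have bound u v : 0 <= u -> u <= v -> v < 1 ->
    `|(fcount A u v)%:R - (v - u) * T| <= a * X.
  by move=> *; apply: le_trans (fcount_bound _ _ _ _) omegaA.
have QT : l * T <= 2 * (size Q)%:R.
  have := bound y z; rewrite -sQ /y /z => h.
  have : `|(size Q)%:R - (x + l / 2 - (x - l / 2)) * T| <= a * X by apply: h; lra.
  rewrite ler_norml => /andP[h1 _].
  by move: h1; rewrite (_ : x + l / 2 - (x - l / 2) = l); lra.
have NQ : N <= 2 * (size Q)%:R * X ^+ 2.
  apply: (le_trans TN).
  have h1 : T * X * 1 <= T * X * (l * X) by rewrite ler_wpM2l // mulr_ge0 // ltW.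
  have h2 : l * T * X ^+ 2 <= 2 * (size Q)%:R * X ^+ 2.
    by rewrite ler_wpM2r // exprn_ge0 // ltW.
  lra.
have Qgt0 : 0 < (size Q)%:R :> R.
  have X20 : 0 < X ^+ 2 by rewrite exprn_gt0.
  by have := lt_le_trans N0 NQ; rewrite pmulr_lgt0 // pmulr_rgt0.
pose e p : R := \sum_(q <- Q | frac R q != frac R p) `|frac R p - frac R q|^-1.
have e0 p : 0 <= e p by apply: sumr_ge0 => q _; rewrite invr_ge0.
have eQ : \sum_(p <- Q) e p <= X * N ^+ 2.
  apply: le_trans (_ : (8 * (2 * k + 3) * (size A * 2 ^ k) ^ 2)%:R <= _); last first.
    by rewrite natrM natrX NE ler_wpM2r // exprn_ge0 // ltW.
  apply: le_trans (fractions_energy R hA).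
  rewrite /Q big_filter [leRHS](bigID (fun p => (y <= frac R p <= z) && coprime p.1 p.2)) /=.
  rewrite -[leLHS]addr0; apply: lerD; last first.
    by apply: sumr_ge0 => p _; apply: sumr_ge0 => q _; rewrite invr_ge0.
  apply: ler_sum => p _; rewrite /e /Q big_filter_cond.
  rewrite [leRHS](bigID (fun p => (y <= frac R p <= z) && coprime p.1 p.2)) /=.
  rewrite -[leLHS]addr0; apply: lerD; last by apply: sumr_ge0 => q _; rewrite invr_ge0.
  by under eq_bigl do rewrite andbC.
(* Discarding the fractions whose energy is more than twice the bound for the mean keeps at least
   half of [Q] and turns an average bound into one for each p. *)
pose P := [seq p <- Q | e p * (size Q)%:R <= 2 * (X * N ^+ 2)].
have QP : (size Q)%:R <= 2 * (size P)%:R :> R.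
  rewrite -natrM ler_nat [size P]size_filter.
  have M0 : 0 < X * N ^+ 2 by rewrite mulr_gt0 // exprn_gt0.
  exact: (count_average_le e0 M0 eQ).
have P0 : 0 < (size P)%:R :> R by lra.
have inQ p : p \in Q -> [/\ p.2 \in A, coprime p.1 p.2, (p.1 < p.2)%N & y <= frac R p <= z].
  by rewrite mem_filter mem_fractions => /andP[/andP[-> ->] /andP[-> ->]].
have PQ p : p \in P -> p \in Q by rewrite mem_filter => /andP[].
have cPQ (c : pred (nat * nat)) : (count c P <= count c Q)%N.
  by apply: leq_count_subseq; apply: filter_subseq.
have eP p : p \in P -> e p <= 4 * X ^+ 3 * N.
  rewrite mem_filter => /andP[h _]; rewrite -(ler_pM2r Qgt0); apply: (le_trans h).
  have h1 : 2 * X * N * N <= 2 * X * N * (2 * (size Q)%:R * X ^+ 2).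
    by rewrite ler_wpM2l // mulr_ge0 ?mulr_ge0 // ltW.
  lra.
(* Small scales: the energy bounds the count by 1 + 12 X^3 N rho, where 1 stands for p itself. The
   hypothesis N r^s >= X^4 absorbs the 1, and X^8 (X^2 / K)^(1 - s) <= 1 turns rho into rho^s with a
   gain of X^8. *)
have small p rho : p \in P -> r <= rho -> rho <= X ^+ 2 / K ->
    (count (fun q => `|frac R q - frac R p| <= 3 * rho) P)%:R <=
    kap * (size P)%:R * rho `^ s.
  move=> pP rr rhoK; have rho0 : 0 < rho by apply: lt_le_trans rr.
  set w := rho `^ s.
  have w0 : 0 < w by rewrite powR_gt0.
  have wE : rho = w * rho `^ (1 - s).
    rewrite -powRD; last by rewrite (gt_eqF rho0) implybT.
    by rewrite addrC subrK powRr1 // ltW.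
  have rX : X ^+ 8 * rho <= w.
    rewrite wE mulrCA -[leRHS]mulr1 ler_pM2l //; apply: le_trans X8.
    rewrite ler_pM2l ?exprn_gt0 //; apply: ge0_ler_powR; rewrite ?nnegrE; lra.
  have Nw : X ^+ 4 <= N * w.
    apply: (le_trans XN); rewrite ler_pM2l //.
    by apply: ge0_ler_powR; rewrite ?nnegrE; lra.
  have c1 : (count (fun q => `|frac R q - frac R p| <= 3 * rho) P)%:R <=
      1 + 12 * X ^+ 3 * N * rho.
    have rho30 : 0 <= 3 * rho by lra.
    apply: le_trans (_ : (count (fun q => `|frac R q - frac R p| <= 3 * rho) Q)%:R <= _).
      by rewrite ler_nat.
    apply: le_trans (count_le_energy (frac R) Q (frac R p) rho30) _.
    rewrite -/(e p); apply: lerD.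
      rewrite lern1 (@leq_trans (count_mem p Q)) //.
        rewrite -!size_filter; apply: uniq_leq_size.
          by rewrite !filter_uniq // fractions_uniq.
        move=> q; rewrite mem_filter => /andP[/eqP qp qQ].
        rewrite mem_filter /= qQ andbT; apply/eqP.
        have [q2 qc _ _] := inQ q qQ; have [p2 pc _ _] := inQ p (PQ p pP).
        by apply: (@frac_inj R); rewrite ?An.
      by rewrite count_uniq_mem ?leq_b1 // filter_uniq // fractions_uniq.
    have hh : 3 * rho * e p <= 12 * X ^+ 3 * N * rho.
      by have := ler_wpM2l (ltW rho0) (eP p pP); lra.
    exact: hh.
  apply: (le_trans c1).
  have PN : N <= kap * (size P)%:R * (4 * X ^+ 3).
    have h1 : 1 * (size P)%:R <= kap * X * (size P)%:R by rewrite ler_wpM2r // ltW.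
    have X20 : 0 <= X ^+ 2 by rewrite exprn_ge0 // ltW.
    have h2 : (size Q)%:R * X ^+ 2 <= 2 * (size P)%:R * X ^+ 2 by rewrite ler_wpM2r.
    have h3 := ler_wpM2r X20 h1.
    lra.
  have X3 : 0 < 4 * X ^+ 3 by rewrite mulr_gt0 // exprn_gt0.
  rewrite -(ler_pM2r X3).
  have hw : N * w <= kap * (size P)%:R * w * (4 * X ^+ 3).
    by have := ler_wpM2r (ltW w0) PN; lra.
  apply: le_trans hw.
  have i1 : 96 * X ^+ 3 <= X ^+ 4.
    by rewrite [X ^+ 4]exprS ler_wpM2r // exprn_ge0 // ltW.
  have i2 : N * (96 * X ^+ 6 * rho) <= N * w.
    rewrite ler_pM2l //; apply: le_trans rX; rewrite ler_pM2r //.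
    rewrite (_ : X ^+ 8 = X * X * X ^+ 6); last by ring.
    rewrite ler_pM2r ?exprn_gt0 //.
    have := ler_pM (ler0n R 96) (ler0n R 1) X96 (_ : 1 <= X).
    by lra.
  lra.
exists P; split.
- by rewrite -(ltr0n R).
- move=> p /PQ/inQ[p2 pc pl /andP[h1 h2]]; split => //.
  by rewrite ler_norml; move: h1 h2; rewrite /y /z => h1 h2; apply/andP; split; lra.
- move=> p pP rho rr; have rho0 : 0 < rho by apply: lt_le_trans rr.
  have [rl|rl] := leP l rho.
    apply: (@le_trans _ _ (size P)%:R); first by rewrite ler_nat count_size.
    have h : 1 <= (rho / l) `^ s.
      rewrite -[leLHS](powRr0 (rho / l)) ler_powR // ?(ltW s0) //.
      by rewrite ler_pdivlMr // mul1r.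
    have := ler_wpM2l (ltW P0) h; lra.
  have rl0 : 0 < rho / l by rewrite divr_gt0.
  have rs1 : rho / l <= (rho / l) `^ s.
    rewrite -{1}(powRr1 (ltW rl0)) ger_powR // ?(ltW s1) //.
    by rewrite rl0 ler_pdivrMr // mul1r ltW.
  have [rK'|rK'] := leP rho (X ^+ 2 / K).
    apply: le_trans (small p rho pP rr rK') _.
    have h1 : rho `^ s <= (rho / l) `^ s.
      apply: ge0_ler_powR; rewrite ?nnegrE ?(ltW rho0) ?(ltW rl0) ?(ltW s0) //.
      by rewrite ler_pdivlMr // ler_piMr // ltW.
    apply: ler_pM; rewrite ?mulr_ge0 ?powR_ge0 ?(ltW kap0) //.
    by rewrite ler_pM2r //; lra.
  (* Intermediate scales X^2 / K < rho < l: the sieve error is at most rho T, so the count is at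
     most 6 rho T + rho T. Since l T <= 2 |Q| <= 4 |P|, this is at most 28 |P| rho / l. *)
  have hT : a * X <= rho * T.
    have h1 : X ^+ 2 / K * T <= rho * T by rewrite ler_wpM2r // ltW.
    apply: le_trans h1.
    rewrite -(ler_pM2r K0) [X in _ <= X](_ : _ = X ^+ 2 * T); last first.
      by field; rewrite gt_eqF.
    have := ler_wpM2l (ltW X0) TN; rewrite /N; lra.
  have [_ _ _ /andP[py pz]] := inQ p (PQ p pP).
  pose u := Num.max (frac R p - 3 * rho) y; pose v := Num.min (frac R p + 3 * rho) z.
  have c1 : (count (fun q => `|frac R q - frac R p| <= 3 * rho)%R P <= fcount A u v)%N.
    apply: leq_trans (cPQ _) _.
    rewrite /Q count_filter /fcount; apply: sub_count => q /= /andP[h /andP[/andP[h1 h2] ->]].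
    move: h; rewrite ler_norml andbT => /andP[h3 h4].
    by rewrite ge_max le_min h1 h2 /=; apply/andP; split; rewrite ?andbT; lra.
  have y0 : 0 <= y by rewrite /y; lra.
  have z1 : z < 1 by rewrite /z; lra.
  have u0 : 0 <= u by rewrite le_max y0 orbT.
  have v1 : v < 1 by rewrite gt_min z1 orbT.
  have yz := le_trans py pz.
  have uv : u <= v.
    by rewrite /u /v ge_max !le_min; apply/andP; split; apply/andP; split; lra.
  have vu : v - u <= 6 * rho.
    have : v <= frac R p + 3 * rho by rewrite ge_min lexx.
    have : frac R p - 3 * rho <= u by rewrite le_max lexx.
    lra.
  have := bound u v u0 uv v1; rewrite ler_norml => /andP[_ h].
  have h1 : (v - u) * T <= 6 * rho * T by rewrite ler_wpM2r.
  apply: le_trans (_ : (fcount A u v)%:R <= _); first by rewrite ler_nat.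
  have h2 : 28 * (size P)%:R * (rho / l) <= 28 * (size P)%:R * (rho / l) `^ s.
    by rewrite ler_pM2l // mulr_gt0.
  apply: le_trans h2.
  have h3 : l * T * (rho / l) <= 4 * (size P)%:R * (rho / l).
    by rewrite ler_pM2r //; lra.
  have h4 : l * T * (rho / l) = rho * T by field; rewrite gt_eqF.
  lra.
- by move=> p pP; apply: small.
Qed.

(** * Choice of the parameters *)

Lemma bernoulli_le (R : realType) (c : R) (k : nat) : 1 <= c ->
  1 + k%:R * (c - 1) <= c ^+ k.
Proof.
move=> c1; elim: k => [|k IH]; first by rewrite mul0r addr0 expr0.
have h1 : c * (1 + k%:R * (c - 1)) <= c * c ^+ k by rewrite ler_wpM2l //; lra.
have h2 : 0 <= k%:R * ((c - 1) * (c - 1)) by rewrite mulr_ge0 // mulr_ge0 // subr_ge0.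
rewrite exprS -natr1; lra.
Qed.

Lemma rich_points (R : realType) (u : nat -> R) (s x l kap : R) (n0 : nat) :
  (forall n, (1 <= n)%N -> 0 <= u n) ->
  (forall s' : R, 0 < s' -> s' < 1 ->
    (\sum_(1 <= n <oo) (u n `^ s' * (totient n)%:R)%:E)%E = +oo%E) ->
  0 < s -> s < 1 -> 0 < l -> 0 < kap -> kap <= 1 ->
  0 <= x - l -> x + l <= 1 ->
  exists r : R, exists P : seq (nat * nat),
  [/\ 0 < r < kap, (0 < size P)%N,
    forall p, p \in P -> [/\ (n0 <= p.2)%N, (1 <= p.1 <= p.2)%N,
      coprime p.1 p.2, r < u p.2 & `|frac R p - x| <= l - r],
    forall p, p \in P -> forall rho, r <= rho ->
      (count (fun q => `|frac R q - frac R p| <= 3 * rho) P)%:R <=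
      28 * (size P)%:R * (rho / l) `^ s &
    forall p, p \in P ->
      (count (fun q => `|frac R q - frac R p| <= 3 * r) P)%:R <=
      kap * (size P)%:R * r `^ s].
Proof.
move=> u0 udiv s0 s1 l0 kap0 kap1 x0 x1.
have s1' : 0 < 1 - s by lra.
(* With e = 1 / (2 m) this means 24 e <= 1 - s. The 24 is what X^4 = 2^(8 k e) <= 2^(k (1 - s) / 3)
   requires, where k (1 - s) / 3 = k (t0 - s) is the surplus left by a class rich for the exponent
   t0. *)
have [m m1 ms] : exists2 m, (0 < m)%N & 12 <= m%:R * (1 - s).
  exists (Num.truncn (12 / (1 - s))).+1 => //.
  by rewrite -ler_pdivrMr // ltW // truncnS_gt.
have m0 : (0 : R) < m%:R by rewrite ltr0n.
pose e : R := (2 * m)%:R^-1.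
have e0 : 0 < e by rewrite invr_gt0 ltr0n muln_gt0.
have e24 : 24 * e <= 1 - s.
  rewrite /e natrM ler_pdivrMr ?mulr_gt0 //; lra.
pose c : R := 2 `^ e.
have c1 : 1 < c by rewrite -[ltLHS](powRr0 2) gt1_powR_lt // ltr1n.
have c0 : 0 < c by lra.
pose C : R := 2 `^ ((2 ^ (2 * m))%:R).
have C0 : 0 < C by rewrite powR_gt0.
(* Lower bounds imposed on Y = c^k: 2 C gives 2^omega(n) <= 2 C Y <= Y^2 = X, the inverses of l and
   kap give l X >= 1 and kap X >= 1, and 40 / (c - 1) gives Y^2 >= 40 k >= 8 (2 k + 3) by
   Bernoulli's inequality. *)
pose B := Num.max 96 (Num.max (2 * C) (Num.max l^-1 (Num.max kap^-1 (40 / (c - 1))))).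
have B0 : 0 < B by rewrite lt_max ltr0n.
have [k1 hk1] : exists k1, forall k, (k1 <= k)%N -> c^-1 ^+ k <= B^-1.
  apply: expr_eventually_le; rewrite ?invr_ge0 ?invr_gt0 ?invf_lt1 //.
  exact: ltW.
pose t0 := s + (1 - s) / 3; pose t1 := s + 2 * (1 - s) / 3.
have [k [j [kk kj rich]]] : exists k j : nat, [/\ (maxn k1 n0.+1 <= k)%N, (k <= j)%N &
    (2 `^ t0) ^+ j.+1 <= (size (rich_class u k j) * 2 ^ k)%:R].
  have [h0 h01 h1] : [/\ 0 <= t0, t0 < t1 & t1 < 1] by rewrite /t0 /t1; split; lra.
  have h1' : 0 < t1 by lra.
  exact: (exists_rich_class _ u0 h0 h01 h1 (udiv _ h1' h1)).
move: kk; rewrite geq_max => /andP[/hk1 Bk n0k].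
pose Y := c ^+ k.
have Y0 : 0 < Y by rewrite exprn_gt0.
have {Bk}YB : B <= Y by move: Bk; rewrite exprVn lef_pV2 ?posrE.
move: YB; rewrite /B !ge_max => /andP[Y96 /andP[YC /andP[Yl /andP[Yk Yc]]]].
pose X := Y ^+ 2; pose K : R := (2 ^ k)%:R.
have K0 : 0 < K by rewrite ltr0n expn_gt0.
have X0 : 0 < X by rewrite exprn_gt0.
have YX : Y <= X by rewrite /X expr2 ler_peMl //; lra.
have XE : X = 2 `^ (2 * (k%:R * e)).
  rewrite /X /Y /c -exprM -powR_mulrn ?powR_ge0 // -powRrM natrM.
  by congr (_ `^ _); ring.
have KE : K = 2 `^ k%:R by rewrite powR_mulrn // -natrX.
have XXE n : X ^+ n = 2 `^ (2 * n%:R * (k%:R * e)).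
  rewrite XE -powR_mulrn ?powR_ge0 // -powRrM; congr (_ `^ _); ring.
have ke0 : 0 <= k%:R * e by rewrite mulr_ge0 // ltW.
have ke24 : 24 * (k%:R * e) <= k%:R * (1 - s).
  by have := ler_wpM2l (ler0n R k) e24; lra.
have ks : k%:R * (1 - s) <= k%:R.
  by rewrite -[leRHS]mulr1 ler_wpM2l //; lra.
have two1 : (1 : R) <= 2 by rewrite ler1n.
have XK : X ^+ 4 <= K by rewrite XXE KE ler_powR //; lra.
pose r : R := 2^-1 ^+ j.+1.
have r0 : 0 < r by rewrite exprn_gt0 // invr_gt0.
have rE : r = 2 `^ (- j.+1%:R).
  by rewrite powRN powR_mulrn // /r exprVn.
have rK : r * 2 <= K^-1.
  rewrite /r exprSr mulfVK ?pnatr_eq0 // exprVn lef_pV2 ?posrE ?exprn_gt0 //.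
  by rewrite /K natrX ler_weXn2l // ler1n.
have X1 : 1 <= X by lra.
have XX4 : X <= X ^+ 4 by rewrite ler_eXnr.
have KX : K^-1 <= X^-1 by rewrite lef_pV2 ?posrE //; lra.
have rX : r * 2 <= X^-1 by lra.
have lX : 1 <= l * X by rewrite mulrC -ler_pdivrMr // mul1r; lra.
have kX : 1 <= kap * X by rewrite mulrC -ler_pdivrMr // mul1r; lra.
have Xl : X^-1 <= l by rewrite -[leRHS]invrK lef_pV2 ?posrE ?invr_gt0 //; lra.
have Xkap : X^-1 <= kap by rewrite -[leRHS]invrK lef_pV2 ?posrE ?invr_gt0 //; lra.
have hA n : n \in rich_class u k j -> (2 ^ k <= n < 2 ^ k.+1)%N.
  by rewrite mem_filter mem_iota expnS mul2n addnn => /andP[].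
have k0 : (1 <= k)%N by apply: leq_ltn_trans n0k.
have [||||||||||||||||||P [P0 PA P1 P2]] :=
  @good_fractions R (rich_class u k j) k X r l kap s x _ hA => //.
- by rewrite filter_uniq ?iota_uniq.
- move=> n nA; have /andP[kn nk] := hA n nA.
  have n1 : (0 < n)%N by apply: leq_trans kn; rewrite expn_gt0.
  have M0 : (0 < 2 * m)%N by rewrite muln_gt0.
  apply: le_trans (omega_le_powR R M0 n1) _; rewrite -/C -/e.
  have h : n%:R `^ e <= 2 * Y.
    apply: le_trans (_ : (2 * K) `^ e <= _).
      apply: ge0_ler_powR; rewrite ?nnegrE ?mulr_ge0 // ?ltW //.
      by rewrite -natrM -expnS ltr_nat.
    rewrite powRM ?(ltW K0) //; apply: ler_pM; rewrite ?powR_ge0 //.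
      rewrite -[leRHS]powRr1 // ler_powR //; lra.
    by rewrite KE -powRrM /Y /c -powR_mulrn ?powR_ge0 // -powRrM mulrC.
  have h2 : 2 * C * Y <= Y * Y by rewrite ler_wpM2r // ltW.
  have := ler_wpM2l (ltW C0) h; rewrite /X; lra.
- by lra.
- have h1 := bernoulli_le k (ltW c1).
  have h2 : 40 <= Y * (c - 1) by rewrite -ler_pdivrMr // subr_gt0.
  have h3 : Y * (k%:R * (c - 1)) <= Y * Y by rewrite ler_wpM2l ?(ltW Y0) // /Y; lra.
  have h4 : k%:R * 40 <= k%:R * (Y * (c - 1)) by rewrite ler_wpM2l.
  have h5 : (1 : R) <= k%:R by rewrite ler1n.
  by rewrite natrM natrD natrM /X; lra.
- apply: le_trans (_ : K^-1 <= _); first by lra.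
  by rewrite ler_peMl ?invr_ge0 ?(ltW K0) // exprn_ege1.
- rewrite XXE rE -powRrM.
  apply: le_trans (_ : (2 `^ t0) ^+ j.+1 * 2 `^ (- j.+1%:R * s) <= _); last first.
    by rewrite ler_wpM2r ?powR_ge0.
  rewrite -powR_mulrn ?powR_ge0 // -powRrM -powRD ?pnatr_eq0 ?implybT //.
  rewrite ler_powR // /t0.
  have jk : k%:R <= j.+1%:R :> R by rewrite ler_nat leqW.
  have := ler_wpM2r (ltW s1') jk; lra.
- rewrite XXE XXE -/K KE -powRN -powRD ?pnatr_eq0 ?implybT // -powRrM.
  rewrite -powRD ?pnatr_eq0 ?implybT //.
  rewrite -[leRHS](powRr0 2) ler_powR //.
  have := ler_wpM2l ke0 (ltW s1'); have := ler_wpM2l ke0 (ltW s0).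
  lra.
have rl : l / 2 <= l - r by lra.
exists r, P; split; [by rewrite r0 /=; lra|exact: P0| |exact: P1|exact: P2].
move=> p /PA[pA pc pl pd].
have /andP[h1 h2] := hA _ pA.
have kp : (k < p.2)%N by apply: leq_trans h1; apply: ltn_expl.
split.
- by apply: ltnW; apply: ltn_trans kp.
(* The numerator 0 is coprime to the denominator 1 only, and here the denominator exceeds k >= 1. *)
- rewrite (ltnW pl) andbT lt0n; apply: contraTneq pc => ->.
  by rewrite /coprime gcd0n gtn_eqF // (leq_ltn_trans k0).
- exact: pc.
- by move: pA; rewrite mem_filter => /andP[].
- exact: le_trans pd rl.
Qed.

(** * Passing to a smaller interval of proportionally small cost *)

Definition meets (R : realType) (V : set R) (x l : R) : bool :=
  `[< exists2 z, V z & `|z - x| <= l >].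

(** Restricted to the first N sets to keep the sums finite; bounds uniform in N stand for a bound on
    the full cost. *)
Definition cost (R : realType) (U : nat -> set R) (rho : nat -> R) (s : R)
    (N : nat) (x l : R) : R :=
  \sum_(i < N | meets (U i) x l) rho i `^ s.

Lemma cost_le (R : realType) (U : nat -> set R) (rho : nat -> R) (s : R)
    (N N' : nat) (x l : R) : (N <= N')%N ->
  cost U rho s N x l <= cost U rho s N' x l.
Proof.
move=> NN'.
rewrite /cost -!(big_mkord (fun i => meets (U i) x l) (fun i => rho i `^ s)).
rewrite [leRHS](@big_cat_nat _ _ _ N) //= lerDl.
by apply: sumr_ge0 => i _; rewrite powR_ge0.
Qed.

(* Averaging over P the cost truncated at c r^s for the sets larger than r: the
   separation hypotheses bound the number of points of P close to each U i. *)
Lemma cost_step_finite (R : realType) (U : nat -> set R) (rho : nat -> R)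
    (s x l r : R) (N : nat) (P : seq (nat * nat)) :
  (forall i, 0 < rho i) ->
  (forall i y z, U i y -> U i z -> `|y - z| <= rho i) ->
  0 < s -> 0 < l -> l <= 1 -> 0 < r -> (0 < size P)%N ->
  (forall p, p \in P -> `|frac R p - x| <= l - r) ->
  (forall p, p \in P -> forall d, r <= d ->
      (count (fun q => `|frac R q - frac R p| <= 3 * d) P)%:R <=
      28 * (size P)%:R * (d / l) `^ s) ->
  (forall p, p \in P ->
      (count (fun q => `|frac R q - frac R p| <= 3 * r) P)%:R <=
      2^-1 * (size P)%:R * r `^ s) ->
  cost U rho s N x l <= 56^-1 * l `^ s ->
  exists2 p, p \in P & cost U rho s N (frac R p) r <= 56^-1 * r `^ s.
Proof.
move=> rho0 dU s0 l0 l1 r0 P0 Px P1 P2 hcost.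
apply: contrapT => hno.
have hP p : p \in P -> 56^-1 * r `^ s < cost U rho s N (frac R p) r.
  by move=> pP; rewrite ltNge; apply/negP => h; apply: hno; exists p.
pose c : R := 56^-1 * r `^ s.
have rs0 : 0 < r `^ s by rewrite powR_gt0.
have ls0 : 0 < l `^ s by rewrite powR_gt0.
have c0 : 0 < c by rewrite mulr_gt0 // invr_gt0.
pose f i : R := if rho i < r then rho i `^ s else c.
have f0 i : 0 <= f i by rewrite /f; case: ifP => _; rewrite ?powR_ge0 // ltW.
(* If a set with rho i >= r meets the interval, its truncated term c suffices; otherwise nothing is
   truncated and [hP] applies. *)
have hF p : p \in P -> c <= \sum_(i < N | meets (U i) (frac R p) r) f i.
  move=> pP; case: (pselect (exists i : 'I_N, meets (U i) (frac R p) r && (r <= rho i))).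
    move=> [i /andP[mi ri]]; rewrite (bigD1 i) //= {1}/f ltNge ri /= lerDl.
    exact: sumr_ge0.
  move=> hn; apply: ltW; apply: lt_le_trans (hP p pP) _; apply: ler_sum => i mi.
  rewrite /f; case: ltP => // ri.
  by exfalso; apply: hn; exists i; rewrite mi ri.
pose n : R := (size P)%:R.
have n0 : 0 < n by rewrite ltr0n.
pose D : R := n * r `^ s / l `^ s / 2.
have D0 : 0 < D by rewrite !divr_gt0 // mulr_gt0.
have h1 : n * c <= \sum_(p <- P) \sum_(i < N | meets (U i) (frac R p) r) f i.
  rewrite /n -sum1_size natr_sum mulr_suml big_seq_cond [leRHS]big_seq_cond.
  by apply: ler_sum => p /andP[pP _]; rewrite mul1r; apply: hF.
have h2 : \sum_(p <- P) \sum_(i < N | meets (U i) (frac R p) r) f i <=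
    D * cost U rho s N x l.
  rewrite (exchange_big_dep xpredT) //= /cost mulr_sumr [leRHS]big_mkcond /=.
  apply: ler_sum => i _.
  have -> : \sum_(p <- P | meets (U i) (frac R p) r) f i =
      (count (fun p => meets (U i) (frac R p) r) P)%:R * f i.
    by rewrite big_const_seq iter_addr_0 mulr_natl.
  case: (pselect (exists2 p, p \in P & meets (U i) (frac R p) r)); last first.
    move=> hn; have -> : count (fun p => meets (U i) (frac R p) r) P = 0%N.
      apply/eqP; rewrite -leqn0 leqNgt -has_count; apply/hasP => -[p pP mp].
      by apply: hn; exists p.
    by rewrite mul0r; case: ifP => // _; rewrite mulr_ge0 ?powR_ge0 // ltW.
  move=> [p pP /asboolP[z Uz zp]].
  have -> : meets (U i) x l.
    apply/asboolP; exists z => //; have := Px p pP; move: zp.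
    rewrite !ler_norml => /andP[? ?] /andP[? ?]; apply/andP; split; lra.
  (* Both centres are within r of points of [U i], and these points are at most rho i apart, so the
     centres differ by at most 2 r + rho i <= 3 d. *)
  have close d : r <= d -> rho i <= d ->
      (count (fun q => meets (U i) (frac R q) r) P)%:R <=
      (count (fun q => `|frac R q - frac R p| <= 3 * d) P)%:R :> R.
    move=> rd rhod; rewrite ler_nat; apply: sub_count => q /asboolP[z' Uz' zq].
    have := dU i z z' Uz Uz'; move: zp zq; rewrite !ler_norml.
    by move=> /andP[? ?] /andP[? ?] /andP[? ?]; apply/andP; split; lra.
  have ri0 : 0 <= rho i `^ s by rewrite powR_ge0.
  rewrite /f; case: ltP => ri.
    rewrite ler_wpM2r //; apply: le_trans (close r (lexx _) (ltW ri)) _.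
    apply: (le_trans (P2 p pP)); rewrite /D -/n.
    have ls1 : l `^ s <= 1.
      have := @ge0_ler_powR R s (ltW s0) l 1.
      by rewrite !nnegrE powR1 ler01 (ltW l0); apply.
    have : 1 <= (l `^ s)^-1 by rewrite invf_ge1.
    have nr : 0 < n * r `^ s by rewrite mulr_gt0.
    by move=> /(ler_wpM2l (ltW nr)); lra.
  (* As c = r^s / 56, the product 28 n (rho i / l)^s c equals D (rho i)^s. *)
  have := le_trans (close (rho i) ri (lexx _)) (P1 p pP (rho i) ri).
  move=> /(ler_wpM2r (ltW c0)) h; apply: (le_trans h).
  rewrite powRM ?invr_ge0 ?(ltW l0) ?(ltW (rho0 i)) //.
  have -> : l^-1 `^ s = (l `^ s)^-1.
    by rewrite -powR_inv1 ?(ltW l0) // -powRrM mulN1r powRN.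
  by rewrite /D /c -/n; lra.
have h3 : D * cost U rho s N x l <= n * c / 2.
  apply: le_trans (_ : D * (56^-1 * l `^ s) <= _); first by rewrite ler_pM2l.
  rewrite /D /c le_eqVlt; apply/orP; left; apply/eqP.
  by field; rewrite gt_eqF.
have nc : 0 < n * c by rewrite mulr_gt0.
lra.
Qed.

(** [P] is finite: if every p failed at some N, the largest of these N would contradict
    [cost_step_finite]. *)
Lemma cost_step (R : realType) (U : nat -> set R) (rho : nat -> R)
    (s x l r : R) (P : seq (nat * nat)) :
  (forall i, 0 < rho i) ->
  (forall i y z, U i y -> U i z -> `|y - z| <= rho i) ->
  0 < s -> 0 < l -> l <= 1 -> 0 < r -> (0 < size P)%N ->
  (forall p, p \in P -> `|frac R p - x| <= l - r) ->
  (forall p, p \in P -> forall d, r <= d ->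
      (count (fun q => `|frac R q - frac R p| <= 3 * d) P)%:R <=
      28 * (size P)%:R * (d / l) `^ s) ->
  (forall p, p \in P ->
      (count (fun q => `|frac R q - frac R p| <= 3 * r) P)%:R <=
      2^-1 * (size P)%:R * r `^ s) ->
  (forall N, cost U rho s N x l <= 56^-1 * l `^ s) ->
  exists2 p, p \in P & forall N, cost U rho s N (frac R p) r <= 56^-1 * r `^ s.
Proof.
move=> rho0 dU s0 l0 l1 r0 P0 Px P1 P2 hcost.
apply: contrapT => hno.
have hN p : exists N, p \in P -> 56^-1 * r `^ s < cost U rho s N (frac R p) r.
  case: (pselect (p \in P)) => pP; last by exists 0%N.
  apply: contrapT => hn; apply: hno; exists p => // N.
  by rewrite leNgt; apply/negP => h; apply: hn; exists N.
have [N {}hN] := choice hN.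
have [p pP] := @cost_step_finite R U rho s x l r (\max_(p <- P) N p) P rho0 dU s0
  l0 l1 r0 P0 Px P1 P2 (hcost _).
rewrite leNgt => /negP; apply; apply: lt_le_trans (hN p pP) _.
by apply: cost_le; apply: leq_bigmax_seq.
Qed.

(** * The nested intervals and their common point *)

Lemma limsup_not_covered (R : realType) (u : nat -> R) (U : nat -> set R)
    (rho : nat -> R) (s : R) :
  (forall n, (1 <= n)%N -> 0 <= u n) ->
  (forall s' : R, 0 < s' -> s' < 1 ->
    (\sum_(1 <= n <oo) (u n `^ s' * (totient n)%:R)%:E)%E = +oo%E) ->
  0 < s -> s < 1 ->
  (forall i, 0 < rho i) ->
  (forall i y z, U i y -> U i z -> `|y - z| <= rho i) ->
  (forall N, \sum_(i < N) rho i `^ s <= 56^-1 * 4^-1 `^ s) ->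
  exists x, [/\ 0 <= x < 1, forall i, ~ U i x & forall n0, exists p : nat * nat,
    [/\ (n0 <= p.2)%N, (1 <= p.1 <= p.2)%N, coprime p.1 p.2 &
      `|x - frac R p| < u p.2]].
Proof.
move=> u0 udiv s0 s1 rho0 dU hsum.
pose good (t : R * R) := [/\ 0 < t.2, 0 <= t.1 - t.2, t.1 + t.2 <= 1 &
  forall N, cost U rho s N t.1 t.2 <= 56^-1 * t.2 `^ s].
pose next n0 (t t' : R * R) := [/\ t'.2 <= t.2 / 2, `|t'.1 - t.1| <= t.2 - t'.2 &
  exists p : nat * nat, [/\ (n0 <= p.2)%N, (1 <= p.1 <= p.2)%N, coprime p.1 p.2 &
    t'.1 = frac R p /\ t'.2 < u p.2]].
have step (st : nat * (R * R)) : exists t', good st.2 -> good t' /\ next st.1 st.2 t'.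
  case: st => n0 [x l] /=; case: (pselect (good (x, l))) => g; last by exists (x, l).
  have [/= l0 x0 x1 hc] := g.
  (* This value both halves the radius and, as l <= 1, supplies the factor 1/2 in the last
     hypothesis on counts of [cost_step]. *)
  pose kap : R := l / 2.
  have kap0 : 0 < kap by rewrite divr_gt0.
  have l1 : l <= 2^-1 by lra.
  have kap1 : kap <= 1 by rewrite /kap; lra.
  have [r [P [/andP[r0 rk] P0 PA P1 P2]]] :=
    rich_points n0 u0 udiv s0 s1 l0 kap0 kap1 x0 x1.
  have [p pP hp] : exists2 p, p \in P &
      forall N, cost U rho s N (frac R p) r <= 56^-1 * r `^ s.
    apply: (@cost_step R U rho s x l r P) => //; first by lra.
      by move=> p /PA[].
    move=> p pP; apply: (le_trans (P2 p pP)).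
    rewrite ler_wpM2r ?powR_ge0 // ler_wpM2r //.
    by rewrite /kap; lra.
  exists (frac R p, r) => _; have [p1 p2 p3 p4 p5] := PA p pP.
  split; first split => //=.
  - by move: p5; rewrite ler_norml => /andP[? ?]; lra.
  - by move: p5; rewrite ler_norml => /andP[? ?]; lra.
  by split => //=; [exact: ltW | exists p].
have [g hg] := choice step.
(* The passage from k to k + 1 demands a denominator at least k, so the denominators are unbounded.
   The start is [1/4, 3/4], of radius 1/4, whence the power of 1/4 in the bound on the total
   cost. *)
pose t := fix t k : R * R := if k is k'.+1 then g (k', t k') else (2^-1, 4^-1).
have tgood k : good (t k).
  elim: k => [|k IH] /=; last by have [] := hg (k, t k) IH.
  split => /=; rewrite ?invr_gt0 //; try lra.
  move=> N; apply: le_trans (hsum N); rewrite /cost big_mkcond.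
  by apply: ler_sum => i _; case: ifP => _; rewrite ?powR_ge0.
have tnext k : next k (t k) (t k.+1) by have [] := hg (k, t k) (tgood k).
have nested i j : (i <= j)%N -> (t i).1 - (t i).2 <= (t j).1 - (t j).2 /\
    (t j).1 + (t j).2 <= (t i).1 + (t i).2.
  elim: j => [|j IH]; first by rewrite leqn0 => /eqP ->.
  rewrite leq_eqVlt => /orP[/eqP -> //|]; rewrite ltnS => /IH[h1 h2].
  have [_ + _] := tnext j; rewrite ler_norml => /andP[h3 h4]; lra.
have cross i j : (t i).1 - (t i).2 <= (t j).1 + (t j).2.
  have [ti _ _ _] := tgood i; have [tj _ _ _] := tgood j.
  by case: (leqP i j) => [/nested[]|/ltnW/nested[]]; lra.
pose S := range (fun k => (t k).1 - (t k).2).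
pose x := sup S.
have xin k : `|x - (t k).1| <= (t k).2.
  have S0 : S !=set0 by exists ((t 0%N).1 - (t 0%N).2); exists 0%N.
  have Sub : ubound S ((t k).1 + (t k).2) by move=> _ [i _ <-]; exact: cross.
  have : (t k).1 - (t k).2 <= x by apply: ub_le_sup; [exists ((t k).1 + (t k).2)|exists k].
  have : x <= (t k).1 + (t k).2 by apply: ge_sup.
  by rewrite ler_norml => ? ?; apply/andP; split; lra.
have tsmall k : (t k).2 <= 2^-1 ^+ k.
  elim: k => [|k IH]; first by rewrite expr0 /=; lra.
  have [h _ _] := tnext k; rewrite exprS; lra.
exists x; split.
- by have /= := xin 0%N; rewrite ler_norml => /andP[? ?]; apply/andP; split; lra.
(* If [U i] contained x, it would meet every interval and cost (rho i)^s each time, which exceeds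
   l^s / 56 once l <= rho i / 2. Positivity of rho i is essential here. *)
- move=> i Ui; have [tk0 _ _ _] := tgood 0%N.
  have e0 : 0 < rho i / 2 by rewrite divr_gt0.
  have h1 : (2^-1 : R) < 1 by rewrite invf_lt1 // ltr1n.
  have h0 : (0 : R) <= 2^-1 by rewrite invr_ge0.
  have [k hk] := expr_eventually_le h0 h1 e0.
  have [lk0 _ _ /(_ i.+1)] := tgood k.
  apply/negP; rewrite -ltNge.
  apply: lt_le_trans (_ : rho i `^ s <= _); last first.
    have mi : meets (U i) (t k).1 (t k).2 by apply/asboolP; exists x.
    rewrite /cost big_mkcond big_ord_recr /= mi lerDr.
    by apply: sumr_ge0 => j _; case: ifP => _; rewrite ?powR_ge0.
  have h2 : (t k).2 `^ s <= rho i `^ s.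
    apply: ge0_ler_powR; rewrite ?nnegrE ?(ltW s0) ?(ltW lk0) ?(ltW (rho0 i)) //.
    by have := tsmall k; have := hk k (leqnn k); lra.
  have : 0 < rho i `^ s by rewrite powR_gt0.
  lra.
- move=> n0; have [_ _ [p [p1 p2 p3 [p4 p5]]]] := tnext n0; exists p; split => //.
  by rewrite -p4; apply: le_lt_trans (xin n0.+1) p5.
Qed.

(** * From covers to radii: the lower bound for the dimension *)

Lemma le_diameter (R : realType) (U : set R) (x y : R) : U x -> U y ->
  (`|x - y|%:E <= diameter U)%E.
Proof. by move=> Ux Uy; apply: ereal_sup_ubound; exists x, y. Qed.

Lemma diameter_ge0 (R : realType) (U : set R) : U !=set0 -> (0 <= diameter U)%E.
Proof. by move=> [x Ux]; have := le_diameter Ux Ux; rewrite subrr normr0. Qed.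

Lemma diameter_pow_ge0 (R : realType) (s : R) (U : set R) :
  (0 <= diameter_pow s U)%E.
Proof. by rewrite /diameter_pow; case: ifP => // _; exact: poweR_ge0. Qed.

(* The exponent is raised from s to s', which makes room for replacing the
   diameters by positive numbers. *)
Lemma cover_radii (R : realType) (s s' e : R) (U : nat -> set R) :
  0 <= s -> s < s' -> 0 < e ->
  (forall i, (diameter (U i) <= 1%:E)%E) ->
  (\sum_(0 <= i <oo) diameter_pow s (U i) < e%:E)%E ->
  exists rho : nat -> R, [/\ forall i, 0 < rho i,
    forall i y z, U i y -> U i z -> `|y - z| <= rho i &
    forall N, \sum_(i < N) rho i `^ s' <= 2 * e].
Proof.
move=> s0 ss e0 dU hsum; have s'0 : 0 < s' by apply: le_lt_trans ss.
pose d i : R := if U i == set0 then 0 else fine (diameter (U i)).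
have dfin i : U i !=set0 -> diameter (U i) = (fine (diameter (U i)))%:E.
  move=> /diameter_ge0 h; rewrite fineK // ge0_fin_numE //.
  by apply: le_lt_trans (dU i) _; rewrite ltry.
have d01 i : 0 <= d i <= 1.
  rewrite /d; case: ifPn => [_|/set0P h]; first by rewrite lexx ler01.
  by rewrite -!lee_fin -dfin // dU diameter_ge0.
have dsum N : \sum_(i < N) d i `^ s' <= e.
  rewrite -lee_fin; apply: le_trans (ltW hsum).
  apply: le_trans (_ : (\sum_(0 <= i < N) diameter_pow s (U i) <= _)%E); last first.
    by apply: nneseries_lim_ge => i _ _; exact: diameter_pow_ge0.
  rewrite big_mkord -sumEFin; apply: lee_sum => i _.
  rewrite /diameter_pow /d; case: ifPn => [_|/set0P h].
    by rewrite powR0 // gt_eqF.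
  have := d01 i; rewrite /d; case: ifPn => [/eqP h'|_]; first by case: h => x; rewrite h'.
  rewrite [X in poweR X s](dfin i h) poweR_EFin lee_fin => /andP[h0 h1].
  (* A diameter d in (0, 1] satisfies d^s' <= d^s; for d = 0 the left side vanishes because s' > 0,
     also when s = 0. *)
  have [->|hn] := eqVneq (fine (diameter (U i))) 0.
    by rewrite powR0 ?powR_ge0 // gt_eqF.
  by by apply: ger_powR; rewrite ?(ltW ss) // h1 andbT lt_neqAle eq_sym hn h0.
(* Chosen so that the s'-th powers sum to at most e; the diameters account for the other e in the
   bound 2 e. *)
pose eta (i : nat) : R := (e * 2^-1 ^+ i.+1) `^ s'^-1.
have eta0 i : 0 < eta i by rewrite powR_gt0 // mulr_gt0 // exprn_gt0 // invr_gt0.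
have etas i : eta i `^ s' = e * 2^-1 ^+ i.+1.
  have e1 : 0 <= e * 2^-1 ^+ i.+1 by rewrite ltW // mulr_gt0 // exprn_gt0 // invr_gt0.
  by rewrite /eta -powRrM mulVf ?powRr1 // gt_eqF.
exists (fun i => Num.max (d i) (eta i)); split.
- by move=> i; rewrite lt_max eta0 orbT.
- move=> i y z Uy Uz; rewrite le_max; apply/orP; left; rewrite /d.
  have U0 : U i !=set0 by exists y.
  by rewrite ifF; [rewrite -lee_fin -dfin // le_diameter|apply/negP/negP/set0P].
- move=> N.
  apply: le_trans (_ : \sum_(i < N) (d i `^ s' + eta i `^ s') <= _).
    apply: ler_sum => i _; rewrite maxEle; case: ifP => _.
      by rewrite lerDr powR_ge0.
    by rewrite lerDl powR_ge0.
  rewrite big_split /= mulrDl mul1r; apply: lerD; first exact: dsum.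
  under eq_bigr do rewrite etas.
  rewrite -mulr_sumr -[leRHS]mulr1 ler_pM2l //.
  have h0 : (0 : R) <= 2^-1 by rewrite invr_ge0.
  have h1 : (2^-1 : R) < 1 by rewrite invf_lt1 // ltr1n.
  have := geometric_le 1 N.+1 h0 h1.
  rewrite big_add1 /= big_mkord expr1 => h; apply: (le_trans h).
  by rewrite ler_pdivrMr; lra.
Qed.

Lemma hausdorff_measure_pos (R : realType) (psi : nat -> R) (s : R) :
  (forall n, (1 <= n)%N -> 0 <= psi n) ->
  (forall s' : R, 0 < s' -> s' < 1 ->
    (\sum_(1 <= n <oo) ((psi n / n%:R) `^ s' * (totient n)%:R)%:E)%E = +oo%E) ->
  0 <= s -> s < 1 -> hausdorff_measure s (W psi) <> 0%E.
Proof.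
move=> psi0 pdiv s0 s1 H0.
pose s' := (1 + s) / 2.
have s'0 : 0 < s' by rewrite /s'; lra.
have s'1 : s' < 1 by rewrite /s'; lra.
have ss' : s < s' by rewrite /s'; lra.
(* Here 112 = 2 * 56: [cover_radii] doubles the cost, and [limsup_not_covered] allows (1/4)^s' /
   56. *)
pose e : R := 112^-1 * 4^-1 `^ s'.
have e0 : 0 < e by rewrite mulr_gt0 ?powR_gt0 // invr_gt0.
have : (hausdorff_premeasure s 1 (W psi) < e%:E)%E.
  apply: le_lt_trans (_ : (hausdorff_measure s (W psi) < _)%E).
    by apply: ereal_sup_ubound; exists 1 => //=.
  by rewrite H0 lte_fin.
move=> /ereal_inf_lt[_ [U [Wcov dU] <-] hU].
have [rho [rho0 drho srho]] := cover_radii s0 ss' e0 dU hU.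
have u0 n : (1 <= n)%N -> 0 <= psi n / n%:R.
  by move=> n1; rewrite divr_ge0 // psi0.
have [x [x01 xU xW]] : exists x, [/\ 0 <= x < 1, forall i, ~ U i x &
    forall n0, exists p : nat * nat,
    [/\ (n0 <= p.2)%N, (1 <= p.1 <= p.2)%N, coprime p.1 p.2 &
      `|x - frac R p| < psi p.2 / p.2%:R]].
  apply: (limsup_not_covered u0 pdiv s'0 s'1 rho0 drho) => N.
  by apply: (le_trans (srho N)); rewrite /e; lra.
have : W psi x.
  move=> m m1; have [[a n] /= [mn an can xan]] := xW m.
  exists n => //=; split => //; exists a, 0; split => //.
  by move: xan; rewrite /frac /= addr0 ltr_norml !mulrDl mulNr => /andP[h1 h2]; apply/andP; split; lra.
by move=> /Wcov[i _ Ui]; exact: (xU i).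
Qed.

(** * The upper bound for the dimension, and the theorem *)

Lemma hausdorff_premeasure_ge0 (R : realType) (s delta : R) (A : set R) :
  (0 <= hausdorff_premeasure s delta A)%E.
Proof.
apply: le_ereal_inf_tmp => _ [U _ <-].
by apply: nneseries_ge0 => i _ _; exact: diameter_pow_ge0.
Qed.

Lemma hausdorff_premeasure_unit (R : realType) (s delta : R) (n : nat) (A : set R) :
  0 < s -> A `<=` [set x | 0 <= x < 1] -> n.+1%:R^-1 <= delta ->
  (hausdorff_premeasure s delta A <= (n.+1%:R * n.+1%:R^-1 `^ s)%:E)%E.
Proof.
move=> s0 A01 nd; have n0 : (0 : R) < n.+1%:R by rewrite ltr0n.
pose U i : set R := if (i <= n)%N then
  [set x | i%:R / n.+1%:R <= x < (i%:R + 1) / n.+1%:R] else set0.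
have dU i : (diameter (U i) <= (n.+1%:R^-1)%:E)%E.
  apply: ge_ereal_sup => _ [x [y [Ux Uy ->]]]; rewrite lee_fin.
  move: Ux Uy; rewrite /U; case: ifP => // _ /=; rewrite mulrDl mul1r.
  move: n.+1%:R^-1 (i%:R / _) => b a.
  move=> /andP[? ?] /andP[? ?]; rewrite ler_norml; apply/andP; split; lra.
apply: le_trans (_ : (\sum_(0 <= i <oo) diameter_pow s (U i) <= _)%E).
  apply: ereal_inf_lbound; exists U => //; split; last first.
    by move=> i; apply: le_trans (dU i) _; rewrite lee_fin.
  move=> x /A01/andP[x0 x1].
  have nx0 : 0 <= x * n.+1%:R by rewrite mulr_ge0 // ltW.
  have /andP[h1 h2] := truncn_itv nx0.
  exists (Num.truncn (x * n.+1%:R)) => //; rewrite /U ifT /=.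
    by rewrite ler_pdivrMr // ltr_pdivlMr // h1 natr1.
  by rewrite -ltnS -(ltr_nat R); apply: le_lt_trans h1 _; rewrite gtr_pMl.
apply: lime_le; first by apply: is_cvg_nneseries => i _ _; exact: diameter_pow_ge0.
exists n.+1 => // N /= nN.
rewrite (@big_cat_nat _ _ _ n.+1) //= [X in (_ + X)%E](_ : _ = 0%E) ?adde0; last first.
  rewrite big_nat_cond big1 // => i /andP[/andP[ni _] _]; rewrite /diameter_pow ifT // /U ifF //.
  by apply/negbTE; rewrite -ltnNge.
apply: le_trans (_ : (\sum_(0 <= i < n.+1) (n.+1%:R^-1 `^ s)%:E <= _)%E).
  apply: lee_sum => i _; rewrite /diameter_pow; case: ifPn => [_|/set0P Ui].
    by rewrite lee_fin powR_ge0.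
  have := dU i; have := diameter_ge0 Ui; case: (diameter (U i)) => //= d.
  rewrite !lee_fin => d0 dn.
  by apply: ge0_ler_powR; rewrite ?nnegrE ?(ltW s0) // invr_ge0 ltW.
by rewrite sumEFin lee_fin sumr_const_nat subn0 mulr_natl.
Qed.

(** The cover of the unit interval by n + 1 equal intervals costs (n + 1)^(1 - s), which tends to
    0. *)
Lemma hausdorff_measure_unit (R : realType) (s : R) (A : set R) :
  1 < s -> A `<=` [set x | 0 <= x < 1] -> hausdorff_measure s A = 0%E.
Proof.
move=> s1 A01; have s0 : 0 < s by lra.
have h0 delta : 0 < delta -> hausdorff_premeasure s delta A = 0%E.
  move=> d0; apply/eqP; rewrite eq_le hausdorff_premeasure_ge0 andbT.
  apply/lee_addgt0Pr => e e0; rewrite add0e.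
  have [n [nd ne]] : exists n : nat, n.+1%:R^-1 <= delta /\
      n.+1%:R * n.+1%:R^-1 `^ s <= e.
    pose b := e `^ (s - 1)^-1.
    have b0 : 0 < b by rewrite powR_gt0.
    pose n := Num.truncn (Num.max delta^-1 b^-1).
    have hn : Num.max delta^-1 b^-1 < n.+1%:R by exact: truncnS_gt.
    move: hn; rewrite gt_max => /andP[nd nb].
    have n0 : (0 : R) < n.+1%:R by rewrite ltr0n.
    exists n; split.
      by rewrite -[leRHS]invrK lef_pV2 ?posrE ?invr_gt0 // ltW.
    have nb' : n.+1%:R^-1 <= b by rewrite -[leRHS]invrK lef_pV2 ?posrE ?invr_gt0 // ltW.
    have -> : n.+1%:R * n.+1%:R^-1 `^ s = n.+1%:R^-1 `^ (s - 1) :> R.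
      rewrite -[X in X * _]invrK; have : 0 < n.+1%:R^-1 :> R by rewrite invr_gt0.
      move: n.+1%:R^-1 => q q0; rewrite -powR_inv1 ?(ltW q0) // -powRD.
        by rewrite addrC.
      by rewrite (gt_eqF q0) implybT.
    have -> : e = b `^ (s - 1).
      by rewrite /b -powRrM mulVf ?powRr1 ?(ltW e0) // subr_eq0 gt_eqF.
    apply: ge0_ler_powR; rewrite ?nnegrE ?invr_ge0 ?(ltW b0) //.
    by rewrite subr_ge0 ltW.
  by apply: le_trans (hausdorff_premeasure_unit s0 A01 nd) _; rewrite lee_fin.
apply/eqP; rewrite eq_le; apply/andP; split.
  by apply: ge_ereal_sup => _ [delta /= d0 <-]; rewrite h0.
by apply: ereal_sup_ubound; exists 1; rewrite /= ?h0.
Qed.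

Theorem theorem2 (R : realType) (psi : nat -> R)
  (psi_ge0 : forall n : nat, (1 <= n)%N -> 0 <= psi n)
  (psi_div : forall eps : R, 0 < eps ->
    (\sum_(1 <= n <oo) (epowR (psi n / n%:R) (1 - eps) * (totient n)%:R%:E))%E
      = +oo%E) :
  hausdorff_dim (W psi) = 1%E.
Proof.
have pdiv (s : R) : 0 < s -> s < 1 ->
    (\sum_(1 <= n <oo) ((psi n / n%:R) `^ s * (totient n)%:R)%:E)%E = +oo%E.
  (* Taking eps = 1 - s yields the positive exponent s, at which [epowR] and [powR] agree. *)
  move=> s0 s1; have e0 : 0 < 1 - s by rewrite subr_gt0.
  rewrite -(psi_div _ e0); apply: eq_eseriesr => n _.
  rewrite (_ : 1 - (1 - s) = s) /epowR; last by ring.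
  by rewrite ltNge (ltW s0) andbF EFinM.
have W01 : W psi `<=` [set x | 0 <= x < 1].
  by move=> x /(_ 1%N isT)[n _ []].
apply/eqP; rewrite eq_le; apply/andP; split.
  apply/lee_addgt0Pr => e e0; apply: ereal_inf_lbound; exists (1 + e) => //=.
  split; first by lra.
  by apply: hausdorff_measure_unit W01; lra.
apply: le_ereal_inf_tmp => _ [s [s0 Hs] <-]; rewrite lee_fin leNgt; apply/negP => s1.
exact: (hausdorff_measure_pos psi_ge0 pdiv s0 s1 Hs).
Qed.
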